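(* A full word can be realized by a pointed self-transversal curve on a surface if and only if it is odd.
   Context: Words. An alphabet is a finite set; its elements are letters. For $n\ge1$ put $\hat n=\{1,\dots,n\}$. A (signed) word of length $n\ge 1$ in an alphabet $E$ is a pair $(w,S)$ with $w:\hat n\to E$ a map and $S\subset\hat n$ a set. It is full if $w$ is surjective. Elements $k,l\in\hat n$ are $w$-equivalent if $w(k)=w(l)$. The word $(w,S)$ is odd if $S$ meets every $w$-equivalence class in $\hat n$ in an odd number of elements. Words $(w:\hat n\to E,S)$ and $(w':\hat n'\to E',S')$ are congruent if $n=n'$, $S=S'$ and there is a bijection $\psi:E\to E'$ with $\psi w=w'$. There is also a unique empty word of length $0$ in the empty alphabet; it is full (and odd). Curves. A surface is an oriented 2-dimensional manifold, possibly with boundary. $S^1=\{z\in\mathbb{C}: |z|=1\}$ is oriented counterclockwise, $D=\{z\in\mathbb{C}:|z|\le 1\}$. A tame curve on a surface $\Sigma$ is a continuous map $f:S^1\to \Sigma\setminus\partial\Sigma$ such that (i) $f$ is locally injective; (ii) for every $a\in f(S^1)$ there are a closed neighborhood $V\subset\Sigma$ of $a$ and a homeomorphism $V\to D$ sending $a$ to $0$ and $f(S^1)\cap V$ onto $\{z\in D: z^m\in\mathbb{R}\}$ for some positive integer $m=m_a$ (the multiplicity of $a$), and $\mathrm{card}(f^{-1}(a))=m_a$. A crossing is a point of $f(S^1)$ of multiplicity $>1$; the set $\mathrm{cr}_{>1}(f)$ of crossings is finite. ''Curve'' always means a tame curve $f$ together with a finite (possibly empty) set $\mathrm{cr}_1(f)\subset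 f(S^1)\setminus \mathrm{cr}_{>1}(f)$ of points called corners. Put $\mathrm{cr}(f)=\mathrm{cr}_1(f)\cup\mathrm{cr}_{>1}(f)$, $\mathrm{sing}(f)=f^{-1}(\mathrm{cr}(f))$, $n(f)=\mathrm{card}(\mathrm{sing}(f))$. A curve is self-transversal if for every crossing $a$ and any distinct $x,y\in f^{-1}(a)$ there is a homeomorphism of a neighborhood of $a$ onto $\mathbb{R}^2$ whose composition with $f$ sends a neighborhood of $x$ to $\mathbb{R}\times0$ and a neighborhood of $y$ to $0\times\mathbb{R}$. A pointed curve is a curve with a base point in $S^1\setminus\mathrm{sing}(f)$. A flag of $f$ is a pair $(x,\varepsilon)$, $x\in\mathrm{sing}(f)$, $\varepsilon=\pm$, represented by the image of a small arc of $S^1$ starting at $x$ and going counterclockwise if $\varepsilon=+$ (outgoing flag), clockwise if $\varepsilon=-$ (incoming flag); it is a flag at $f(x)$. The flag rotation sends each flag at $a\in\mathrm{cr}(f)$ to the next of the $2m_a$ flags at $a$ encountered when rotating around $a$ in the positive direction of $\Sigma$. Word of a pointed curve. If $n(f)=0$, then $W(f)$ is the empty word. Otherwise let $n=n(f)$ and let $x_1,\dots,x_n$ be the points of $\mathrm{sing}(f)$ in the order met when traversing $S^1$ counterclockwise from the base point. $W(f)=(w,S)$ is the word in the alphabet $\mathrm{cr}(f)$ with $w(k)=f(x_k)$ and $S$ the set of $k\in\hat n$ such that the flag rotation sends $(x_k,+)$ to an incoming flag. A word $W$ is realized by $f$ if $W$ is congruent to $W(f)$. *)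

(* Defs.v *)
From HB Require Import structures.
From mathcomp Require Import all_boot all_order all_algebra.
From mathcomp Require Import all_classical all_reals all_analysis.
From mathcomp Require Import complex.
Import Order.TTheory GRing.Theory Num.Theory.
Import numFieldNormedType.Exports.

Set Implicit Arguments.
Unset Strict Implicit.
Unset Printing Implicit Defensive.

Local Open Scope classical_set_scope.
Local Open Scope ring_scope.

(** * Words *)

(* Words are indexed from 0.  The alphabet is all of [E], which is not required
   to be a [finType] because the alphabet of the word of a curve is a set of
   points of a surface.  Length 0 is allowed: a word of length 0 is full
   exactly when [E] is empty, i.e. when it is the empty word. *)
Record word (E : Type) := Word {
  wlen : nat;
  letter : 'I_wlen -> E;
  marks : {set 'I_wlen} }.

Arguments wlen {E} _.
Arguments letter {E} _ _.
Arguments marks {E} _.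

Definition full (E : Type) (W : word E) :=
  forall e : E, exists k, letter W k = e.

Definition w_equiv (E : eqType) (W : word E) : rel 'I_(wlen W) :=
  fun k l => letter W k == letter W l.

Definition odd_word (E : eqType) (W : word E) :=
  forall k, odd #|[pred l | (l \in marks W) && w_equiv k l]|.

Definition congruent (E E' : Type) (W : word E) (W' : word E') :=
  exists eq_len : wlen W = wlen W',
    (forall k, (k \in marks W) = (cast_ord eq_len k \in marks W')) /\
    exists2 psi : E -> E', bijective psi &
      forall k, psi (letter W k) = letter W' (cast_ord eq_len k).

(** * The plane *)

Section Plane.
Variable R : realType.

Notation plane := (R * R)%type.

(* The norm of the normed module [R * R] is the sup norm, so the Euclidean
   circle and disc are written out. *)
Definition S1 : set plane := [set p | p.1 ^+ 2 + p.2 ^+ 2 = 1].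
Definition disc : set plane := [set p | p.1 ^+ 2 + p.2 ^+ 2 <= 1].
Definition halfplane : set plane := [set p | 0 <= p.2].

Definition polar (q : plane) (r theta : R) : plane :=
  (q.1 + r * cos theta, q.2 + r * sin theta).

(* [x * exp(i s)] *)
Definition turn (x : plane) (s : R) : plane :=
  (x.1 * cos s - x.2 * sin s, x.1 * sin s + x.2 * cos s).

(* [z] in the disc with [z ^ m] real *)
Definition star (m : nat) : set plane :=
  [set p | disc p /\ complex.Im ((Complex p.1 p.2) ^+ m) = 0].

(* The [2m] components of [star m] minus the origin lie on the rays
   [ray m j], in counterclockwise order; [ray m (j + 2 m) = ray m j]. *)
Definition ray (m j : nat) : set plane :=
  [set p | exists2 r, 0 < r & p = polar (0, 0) r (j%:R * pi / m%:R)].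

Definition winding (gamma : R -> plane) (q : plane) (n : int) :=
  exists theta : R -> R,
    [/\ {within `[0, 2 * pi], continuous theta},
        forall t, t \in `[0, 2 * pi] ->
          exists2 r, 0 < r & gamma t = polar q r (theta t)
      & theta (2 * pi) - theta 0 = 2 * pi * n%:~R].

(* Orientation preservation at [q] of a map that is a homeomorphism near [q]
   (only used for such maps): it has local degree [+1] there. *)
Definition preserves_orientation_at (F : plane -> plane) (q : plane) :=
  \forall r \near 0^'+, winding (fun t => F (polar q r t)) (F q) 1.

(* [h] restricts to a homeomorphism from [A] onto [B], with inverse [g];
   values outside [A] and [B] are irrelevant. *)
Definition homeo_on (T U : topologicalType) (A : set T) (B : set U)
    (h : T -> U) (g : U -> T) :=
  [/\ set_fun A B h /\ set_fun B A g,
      (forall x, A x -> g (h x) = x) /\ (forall y, B y -> h (g y) = y),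
      {within A, continuous h} & {within B, continuous g}].

End Plane.

(** * Oriented surfaces *)

Record chart (R : realType) (T : topologicalType) := Chart {
  chart_dom : set T;
  chart_img : set (R * R);
  chart_map : T -> R * R;
  chart_inv : R * R -> T;
  chart_dom_open : open chart_dom;
  chart_img_open :
    exists2 O : set (R * R), open O & chart_img = O `&` @halfplane R;
  chart_homeo : homeo_on chart_dom chart_img chart_map chart_inv }.

(* An oriented topological surface, given by an oriented atlas with values in
   the closed half-plane.  The orientation lives on the interior, so the
   transition maps are constrained only at points of the open half-plane. *)
Record surface (R : realType) := Surface {
  carrier :> topologicalType;
  atlas : set (chart R carrier);
  surface_hausdorff : hausdorff_space carrier;
  surface_second_countable : @second_countable carrier;
  atlas_cover : forall a : carrier, exists2 c, atlas c & chart_dom c a;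
  atlas_oriented : forall c c' a, atlas c -> atlas c' ->
    chart_dom c a -> chart_dom c' a -> 0 < (chart_map c a).2 ->
    preserves_orientation_at (chart_map c' \o chart_inv c) (chart_map c a) }.

Section Curves.
Variables (R : realType) (Sigma : surface R).

Notation plane := (R * R)%type.
Local Notation S1 := (@S1 R).

Definition boundary : set Sigma :=
  [set a | exists c, [/\ atlas c, chart_dom c a & (chart_map c a).2 = 0]].

(** * Tame curves; a map on the circle is a map on the plane of which only the
    restriction to [S1] matters. *)

Section Maps.
Variable f : plane -> Sigma.

Definition locally_injective :=
  forall x, S1 x -> exists2 U, nbhs x U & set_inj (U `&` S1) f.

Definition star_nbhd (a : Sigma) (m : nat) (V : set Sigma)
    (h : Sigma -> plane) (g : plane -> Sigma) :=
  [/\ closed V, nbhs a V, homeo_on V (@disc R) h g, h a = (0, 0)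
    & h @` (f @` S1 `&` V) = @star R m].

Definition has_multiplicity (a : Sigma) (m : nat) :=
  [/\ (0 < m)%N, exists V h g, star_nbhd a m V h g
    & ((S1 `&` f @^-1` [set a]) #= `I_m)%card].

Definition tame :=
  [/\ {within S1, continuous f}, f @` S1 `<=` ~` boundary, locally_injective
    & forall a, (f @` S1) a -> exists m, has_multiplicity a m].

Definition crossings : set Sigma :=
  [set a | (f @` S1) a /\ exists2 m, (1 < m)%N & has_multiplicity a m].

End Maps.

(* A tame curve with its corners [cr_1]. *)
Record curve := Curve {
  curve_map :> plane -> Sigma;
  corners : set Sigma;
  curve_tame : tame curve_map;
  corners_finite : finite_set corners;
  corners_sub : corners `<=` (curve_map @` S1) `\` crossings curve_map }.

Definition cr (f : curve) : set Sigma := corners f `|` crossings f.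

Definition sing (f : curve) : set plane := S1 `&` f @^-1` cr f.

Definition self_transversal (f : curve) :=
  forall a x y, crossings f a -> S1 x -> S1 y -> x <> y ->
    f x = a -> f y = a ->
    exists (N : set Sigma) (h : Sigma -> plane) (g : plane -> Sigma),
      [/\ nbhs a N, homeo_on N [set: plane] h g,
          \forall z \near within S1 (nbhs x), N (f z) /\ (h (f z)).2 = 0
        & \forall z \near within S1 (nbhs y), N (f z) /\ (h (f z)).1 = 0].

Record pointed_curve := PointedCurve {
  pcurve :> curve;
  base : plane;
  base_S1 : S1 base;
  base_nonsing : ~ sing pcurve base }.

(** * Flags *)

(* [(x, true)] is the outgoing flag [(x, +)], [(x, false)] the incoming flag
   [(x, -)]. *)
Definition flag := (plane * bool)%type.

Definition flag_at (f : curve) (a : Sigma) (phi : flag) :=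
  sing f phi.1 /\ f phi.1 = a.

(* A small arc of the circle representing [phi] is mapped by [h] into the
   [j]-th ray of the star. *)
Definition flag_on_ray (f : curve) (h : Sigma -> plane) (m j : nat)
    (phi : flag) :=
  \forall s \near 0^'+,
    ray m j (h (f (turn phi.1 (if phi.2 then s else - s)))).

(* The homeomorphism from a neighborhood of [a] to the disc, with inverse [g],
   preserves orientation. *)
Definition positive_at (a : Sigma) (g : plane -> Sigma) :=
  forall c, atlas c -> chart_dom c a ->
    preserves_orientation_at (chart_map c \o g) (0, 0).

(* This determines [rho] on flags; elsewhere [rho] is arbitrary. *)
Definition is_flag_rotation (f : curve) (rho : flag -> flag) :=
  forall a, cr f a -> exists m V h g,
    [/\ has_multiplicity f a m, star_nbhd f a m V h g, positive_at a g
      & forall phi, flag_at f a phi -> flag_at f a (rho phi) /\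
          exists j, flag_on_ray f h m j phi /\
                    flag_on_ray f h m j.+1 (rho phi)].

(** * The word of a pointed curve *)

(* [t k] is the angle from the base point to the [k]-th singular point. *)
Definition is_word_of (f : pointed_curve) (W : word (set_type (cr f))) :=
  exists (t : 'I_(wlen W) -> R) (rho : flag -> flag),
    [/\ forall k, 0 < t k < 2 * pi,
        forall k l : 'I_(wlen W), (k < l)%N -> t k < t l,
        range (fun k => turn (base f) (t k)) = sing f,
        forall k, set_val (letter W k) = f (turn (base f) (t k))
      & is_flag_rotation f rho /\
        forall k, (k \in marks W) = ~~ (rho (turn (base f) (t k), true)).2].

Definition realized_by (E : Type) (W : word E) (f : pointed_curve) :=
  exists2 W' : word (set_type (cr f)), is_word_of W' & congruent W W'.

End Curves.

(* Main.v *)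
From HB Require Import structures.
Require Import Defs.
From mathcomp Require Import all_boot all_order all_algebra.
From mathcomp Require Import all_classical all_reals all_analysis.
From mathcomp Require Import complex ring lra zify.
Import Order.TTheory GRing.Theory Num.Theory.
Import numFieldNormedType.Exports.

(** Suppose that a self-transversal curve realizes a word, and let [a] be a crossing
of multiplicity [m]. The flag rotation moves each of the [2 m] flags at [a] to the
next of the [2 m] rays of a star, so each ray carries exactly one flag. Two branches
that cross transversally separate each other's flags ([branches_alternate]): otherwise
a small arc around [a] from one flag of the first branch to the other would avoid the
second branch, whereas in coordinates in which the branches are the axes it has to
cross the second axis ([rays_alternate]). Hence the two flags of a branch have equally
many flags on both sides, i.e. they are antipodal. Half a turn around [a] therefore
exchanges outgoing and incoming flags, so that an odd number of changes between
outgoing and incoming occurs on the way; and this is the number of outgoing flags that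
are followed by an incoming one in the full turn, i.e. of the marked occurrences of the
letter [a] ([odd_outgoing_followed_by_incoming], [realized_word_odd]).

Conversely, an odd word is realized on a surface without boundary that is glued from
one plane for each letter ([glued_surface]). A letter with [m] occurrences has [m]
lines through the origin of its plane, at angles that are multiples of [pi / m]. They
can be directed, and distributed to the occurrences, so that exactly those lines whose
occurrence is marked have an outgoing flag followed by an incoming one ([direction]):
the flags alternate as long as there are marked occurrences, and are outgoing for the
rest of half a turn. The positive end of the line of each place of the word
is joined to the negative end of the line of the next place by a line at infinity, near
which [-1/x] is a coordinate if [x] is the coordinate along the line ([neck]). Since
lines through the origin in different directions diverge, the result is Hausdorff
([glued_hausdorff]), and it is oriented because the transitions are composed of
rotations and of maps that increase each coordinate ([param_transition]). The curve
runs along all lines, one after another ([gamma]); in coordinates near each of its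
points it is a union of lines, whence it is tame and self-transversal ([f_tame],
[cornered_curve_transversal]), and its word is the given one ([word_realized]). *)

Set Implicit Arguments.
Unset Strict Implicit.
Unset Printing Implicit Defensive.

Local Open Scope classical_set_scope.
Local Open Scope ring_scope.

(** * Angles and polar coordinates *)

Section Trigonometry.
Variable R : realType.
Implicit Types (a b r s : R) (p q x : R * R).

Lemma two_pi_gt0 : 0 < 2 * pi :> R.
Proof. by rewrite mulr_gt0 ?pi_gt0. Qed.

Lemma cos_sin_period a (z : int) :
  cos (a + 2 * pi * z%:~R) = cos a /\ sin (a + 2 * pi * z%:~R) = sin a.
Proof.
have E (n : nat) : 2 * pi * n%:R = pi *+ 2 *+ n :> R.
  by rewrite -[pi *+ 2 *+ n]mulr_natr -[pi *+ 2]mulr_natl.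
have P (n : nat) (c : R) : cos (c + 2 * pi * n%:R) = cos c /\
    sin (c + 2 * pi * n%:R) = sin c.
  by rewrite E (periodicn (@cosD2pi R)) (periodicn (@sinD2pi R)).
case: z => n; first exact: P.
have := P n.+1 (a + 2 * pi * (Negz n)%:~R).
by rewrite NegzE mulrNz mulrN subrK => -[-> ->].
Qed.

Lemma cos_eq1 s : 0 <= s < 2 * pi -> cos s = 1 -> s = 0.
Proof.
move=> /andP[s0 s2] cs; apply/eqP; rewrite eq_le s0 andbT leNgt.
apply/negP => sp.
have: 0 < sin (s / 2).
  by apply: sin_gt0_pi; rewrite divr_gt0 //= ltr_pdivrMr // mulrC.
have : cos (s / 2 *+ 2) = 1 by rewrite -mulr_natr divfK.
rewrite cos_mulr2n => h; have := cos2Dsin2 (s / 2).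
nra.
Qed.

Lemma angle_uniq a b : 0 <= a < 2 * pi -> 0 <= b < 2 * pi ->
  cos a = cos b -> sin a = sin b -> a = b.
Proof.
wlog ab : a b / b <= a => [H|] ha hb ca sa.
  case: (leP b a) => ab; first exact: H.
  by apply/esym; apply: H => //; exact: ltW.
apply/eqP; rewrite -subr_eq0; apply/eqP; apply: cos_eq1.
  by apply/andP; lra.
by rewrite cosB ca sa -!expr2 cos2Dsin2.
Qed.

Lemma angle_mod a : exists2 z : int, 0 <= a + 2 * pi * z%:~R < 2 * pi
  & a = (a + 2 * pi * z%:~R) - 2 * pi * z%:~R.
Proof.
have := two_pi_gt0; set P := 2 * pi => p0.
exists (- Num.floor (a / P)); last by rewrite addrK.
have /andP[] := Num.Theory.floor_itv (a / P).
rewrite mulrNz mulrN subr_ge0 ltrBlDl ler_pdivlMr // ltr_pdivrMr // intrD mulrDl mul1r.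
by rewrite ![_ * P]mulrC addrC => -> ->.
Qed.

Lemma angle_eq_mod a b : cos a = cos b -> sin a = sin b ->
  exists z : int, a = b + 2 * pi * z%:~R.
Proof.
move=> ca sa.
have [y hy ea] := angle_mod a; have [z hz eb] := angle_mod b.
have [cy sy] := cos_sin_period a y; have [cz sz] := cos_sin_period b z.
have := angle_uniq hy hz; rewrite cy sy cz sz => /(_ ca sa) E.
by exists (z - y); rewrite ea E intrD mulrNz; ring.
Qed.

Lemma S1_angle p : S1 p -> exists2 a, 0 <= a < 2 * pi & p = (cos a, sin a).
Proof.
case: p => x y; rewrite /S1 /= => h.
have x1 : -1 <= x <= 1 by apply/andP; split; nra.
have hx : cos (acos x) = x by rewrite acosK // in_itv.
have hy : Num.sqrt (1 - x ^+ 2) = `|y| by rewrite -sqrtr_sqr -h; congr Num.sqrt; ring.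
have a0 := acos_ge0 x1; have api := acos_lepi x1; have := pi_gt0 R => p0.
case: (leP 0 y) => y0.
  exists (acos x); first by apply/andP; lra.
  by rewrite hx sin_acos // hy ger0_norm.
exists (2 * pi - acos x).
  have : 0 < acos x.
    rewrite lt_neqAle a0 andbT; apply/eqP => e.
    by move: hx; rewrite -e cos0 => e1; move: h; rewrite -e1; nra.
  by move=> ?; apply/andP; lra.
have [c s] := cos_sin_period (- acos x) 1.
move: c s; rewrite mulr1z mulr1 [_ + 2 * pi]addrC => -> ->; rewrite cosN sinN hx sin_acos //.
by rewrite hy ltr0_norm // opprK.
Qed.

Lemma S1_cos_sin a : S1 (cos a, sin a).
Proof. exact: cos2Dsin2. Qed.

Lemma turn_cos_sin a b : turn (cos a, sin a) b = (cos (a + b), sin (a + b)).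
Proof. by rewrite /turn /= cosD sinD; congr pair; ring. Qed.

Lemma turn0 p : turn p 0 = p.
Proof. by case: p => x y; rewrite /turn /= cos0 sin0; congr pair; ring. Qed.

Lemma turnD p a b : turn (turn p a) b = turn p (a + b).
Proof. by rewrite /turn /= cosD sinD; congr pair; ring. Qed.

Lemma turnK a : cancel (@turn R ^~ a) (@turn R ^~ (- a)).
Proof. by move=> p; rewrite turnD subrr turn0. Qed.

Lemma turnNK a : cancel (@turn R ^~ (- a)) (@turn R ^~ a).
Proof. by move=> p; rewrite turnD addNr turn0. Qed.

Lemma turn_origin a : turn (0, 0) a = (0, 0).
Proof. by rewrite /turn /= !mul0r subrr addr0. Qed.

Lemma turn_axis r a : turn (r, 0) a = polar (0, 0) r a.
Proof. by rewrite /turn /polar /=; congr pair; ring. Qed.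

Lemma turn_pi p : turn p pi = - p.
Proof. by case: p => x y; change (- (x, y)) with (- x, - y); rewrite /turn /= cospi sinpi; congr pair; ring. Qed.

Lemma polarNr r a : polar (0, 0) (- r) a = polar (0, 0) r (a + pi).
Proof. by rewrite -!turn_axis addrC -turnD turn_pi; congr turn; congr pair; rewrite oppr0. Qed.

Lemma S1_turn p a : S1 p -> S1 (turn p a).
Proof. by move=> /S1_angle[b _ ->]; rewrite turn_cos_sin; apply: S1_cos_sin. Qed.

Lemma polar_period r a (z : int) :
  polar (0, 0) r (a + 2 * pi * z%:~R) = polar (0, 0) r a.
Proof. by rewrite /polar; have [-> ->] := cos_sin_period a z. Qed.

Lemma plane_polar p : exists r a, [/\ 0 <= r, 0 <= a < 2 * pi & p = polar (0, 0) r a].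
Proof.
pose r := Num.sqrt (p.1 ^+ 2 + p.2 ^+ 2).
have hr : r ^+ 2 = p.1 ^+ 2 + p.2 ^+ 2 by rewrite sqr_sqrtr // addr_ge0 ?sqr_ge0.
have [r0|r0] := eqVneq r 0.
  exists 0, 0; split=> //; first by rewrite lexx two_pi_gt0.
  move: hr; rewrite r0 expr0n /= => /esym/eqP.
  rewrite paddr_eq0 ?sqr_ge0 // !sqrf_eq0 => /andP[/eqP h1 /eqP h2].
  by rewrite /polar !mul0r !addr0 -{1}h1 -h2; case: (p).
have [|a ha ea] := @S1_angle (p.1 / r, p.2 / r).
  by rewrite /S1 /= !expr_div_n -mulrDl -hr divff // expf_neq0.
exists r, a; split=> //; first exact: sqrtr_ge0.
case: ea => /esym e1 /esym e2; rewrite /polar e1 e2 !add0r.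
by rewrite ![r * _]mulrC !divfK //; case: (p).
Qed.

Lemma polar_norm r a : (polar (0, 0) r a).1 ^+ 2 + (polar (0, 0) r a).2 ^+ 2 = r ^+ 2.
Proof. by rewrite /polar /= !add0r !exprMn -mulrDr cos2Dsin2 mulr1. Qed.

Lemma polar_inj r s a b : 0 < r -> 0 < s ->
  polar (0, 0) r a = polar (0, 0) s b ->
  [/\ r = s, cos a = cos b & sin a = sin b].
Proof.
move=> r0 s0 E; have /eqP := polar_norm r a.
rewrite E polar_norm eqrXn2 ?ltW // => /eqP E2.
by move: E; rewrite /polar E2 !add0r => -[/mulfI h1 /mulfI h2];
  split=> //; [apply: h1|apply: h2]; rewrite gt_eqF -?E2.
Qed.

Lemma turn_inj p s s' : S1 p -> 0 < s < 2 * pi -> 0 < s' < 2 * pi ->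
  turn p s = turn p s' -> s = s'.
Proof.
move=> /S1_angle[b _ ->]; wlog ss : s s' / s' <= s => [H|] hs hs'.
  case: (leP s' s) => ss; first exact: H.
  by move=> /esym E; apply/esym; apply: H => //; exact: ltW.
rewrite !turn_cos_sin => -[ec es]; apply/eqP; rewrite -subr_eq0; apply/eqP.
apply: cos_eq1; first by clear -ss hs hs'; apply/andP; lra.
by rewrite (_ : s - s' = (b + s) - (b + s')); [rewrite cosB ec es -!expr2 cos2Dsin2|ring].
Qed.

Lemma ray_mod (m i j : nat) : (0 < m)%N -> i = j %[mod m + m] -> ray m i = ray m j :> set (R * R).
Proof.
move=> m0 ij; wlog le : i j ij / (i <= j)%N => [H|].
  by case: (leqP i j) => le; [exact: H|apply/esym; apply: H => //; exact: ltnW].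
have [z ->] : exists z, j = (i + z * (m + m))%N.
  have : (m + m %| j - i)%N by rewrite -eqn_mod_dvd //; exact/eqP.
  by move=> /dvdnP[z E]; exists z; rewrite -E subnKC.
have E r : polar (0, 0) r ((i + z * (m + m))%:R * pi / m%:R) =
    polar (0, 0) r (i%:R * pi / m%:R) :> R * R.
  rewrite -[RHS](polar_period _ _ z); congr polar.
  have m0' : m%:R != 0 :> R by rewrite pnatr_eq0 -lt0n.
  by rewrite natrD natrM natrD -pmulrn; field.
by apply/seteqP; split => q /= [r r0 ->]; exists r.
Qed.

Lemma ray_disjoint (m i j : nat) q : (0 < m)%N -> ray m i q -> ray m j q -> i = j %[mod m + m].
Proof.
move=> m0; have mm0 : (0 < m + m)%N by rewrite addn_gt0 m0.
rewrite -(@ray_mod m (i %% (m + m)) i) ?modn_mod // -(@ray_mod m (j %% (m + m)) j) ?modn_mod //.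
have hi := ltn_pmod i mm0; have hj := ltn_pmod j mm0.
move: (i %% _)%N (j %% _)%N hi hj => {}i {}j hi hj [r r0 ->] [s s0] /(polar_inj r0 s0)[_ ec es].
have m0' : 0 < m%:R :> R by rewrite ltr0n.
have pi0 := pi_gt0 R.
have rng (k : nat) : (k < m + m)%N -> 0 <= k%:R * (pi : R) / m%:R < 2 * pi.
  move=> hk; apply/andP; split; first by rewrite divr_ge0 ?mulr_ge0 ?(ltW pi0).
  rewrite ltr_pdivrMr // [2 * _]mulrC -mulrA mulrC ltr_pM2l //.
  by rewrite mulr_natl mulr2n -natrD ltr_nat.
have := angle_uniq (rng _ hi) (rng _ hj) ec es.
move=> /(congr1 (fun z => z * m%:R / pi)); rewrite !divfK ?gt_eqF // !mulfK ?gt_eqF //.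
by move=> /eqP; rewrite eqr_nat => /eqP.
Qed.

End Trigonometry.

(** * Topology of the plane *)

Section PlaneTopology.
Variable R : realType.
Notation plane := (R * R)%type.
Implicit Types (p q : plane).

Lemma nbhs_box q (A : set plane) : nbhs q A <->
  exists2 e : R, 0 < e & forall p, `|p.1 - q.1| < e -> `|p.2 - q.2| < e -> A p.
Proof.
split.
  move=> /nbhs_ballP[e /= e0 H]; exists e => // p h1 h2; apply: H.
  by split; rewrite /ball /= distrC.
move=> [e e0 H]; apply/nbhs_ballP; exists e => // p [h1 h2].
by apply: H; rewrite distrC.
Qed.

Lemma nbhs_disc (A : set plane) : nbhs ((0, 0) : plane) A ->
  exists2 e : R, 0 < e & forall p, p.1 ^+ 2 + p.2 ^+ 2 < e ^+ 2 -> A p.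
Proof.
move=> /nbhs_box[e e0 H]; exists e => // p hp.
have sq (x y : R) : x ^+ 2 + y ^+ 2 < e ^+ 2 -> `|x| < e.
  move=> h; rewrite -ltr_sqr ?nnegrE ?normr_ge0 ?ltW // real_normK ?num_real //.
  by have := sqr_ge0 y; lra.
by apply: H; rewrite subr0; [apply: sq hp|rewrite addrC in hp; apply: sq hp].
Qed.

Lemma polar_near q (A : set plane) : nbhs q A ->
  exists2 e : R, 0 < e & forall r t, `|r| < e -> A (polar q r t).
Proof.
move=> /nbhs_box[e e0 H]; exists e => // r t re; apply: H.
  rewrite /polar /= addrAC subrr add0r normrM.
  by apply: le_lt_trans re; rewrite ler_piMr // cos_max.
rewrite /polar /= addrAC subrr add0r normrM.
by apply: le_lt_trans re; rewrite ler_piMr // sin_max.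
Qed.

Lemma cvg_plane (T : Type) (F : set_system T) (FF : Filter F) (f : T -> plane) q :
  (fun x => (f x).1) @ F --> q.1 -> (fun x => (f x).2) @ F --> q.2 -> f @ F --> q.
Proof.
move=> h1 h2.
have -> : f = (fun x => ((f x).1, (f x).2)) by apply/funext => x; case: (f x).
case: q h1 h2 => a b; exact: cvg_pair.
Qed.

Lemma continuous_plane (T : topologicalType) (f : T -> plane) x :
  {for x, continuous (fun x => (f x).1)} -> {for x, continuous (fun x => (f x).2)} ->
  {for x, continuous f}.
Proof. by move=> h1 h2; apply: cvg_plane. Qed.

Lemma continuous_fst_at q : {for q, continuous (fun p : plane => p.1)}.
Proof. exact: cvg_fst. Qed.

Lemma continuous_snd_at q : {for q, continuous (fun p : plane => p.2)}.
Proof. exact: cvg_snd. Qed.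

Lemma continuous_turn (a : R) : continuous (fun p : plane => turn p a).
Proof.
move=> q; apply: continuous_plane => /=.
  apply: continuousB; apply: continuousM; first [exact: cvg_fst|exact: cvg_snd|exact: cst_continuous].
apply: continuousD; apply: continuousM; first [exact: cvg_fst|exact: cvg_snd|exact: cst_continuous].
Qed.

Lemma continuous_turn_angle p : continuous (fun a : R => turn p a).
Proof.
move=> q; apply: continuous_plane => /=.
  apply: continuousB; apply: continuousM;
    first [exact: cst_continuous|exact: continuous_cos|exact: continuous_sin].
apply: continuousD; apply: continuousM;
    first [exact: cst_continuous|exact: continuous_cos|exact: continuous_sin].
Qed.

Lemma continuous_polar_radius q (a : R) : continuous (fun r : R => polar q r a).
Proof.
move=> r; apply: continuous_plane => /=; apply: continuousD; try exact: cst_continuous;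
 by apply: continuousM; [exact: cvg_id|exact: cst_continuous].
Qed.

Lemma continuous_polar_angle q (r : R) : continuous (fun a : R => polar q r a).
Proof.
move=> a; apply: continuous_plane => /=; apply: continuousD; try exact: cst_continuous;
  apply: continuousM; first [exact: cst_continuous|exact: continuous_cos|exact: continuous_sin].
Qed.

End PlaneTopology.

(** * Transversal branches *)

Section Transversality.
Variable R : realType.
Notation plane := (R * R)%type.

(** The intermediate value theorem; as [v] is not 0, it is attained at a positive
    parameter. *)
Lemma germ_IVT (X : R -> R) (rho r v : R) :
  (forall s, `|s| < rho -> {for s, continuous X}) -> X 0 = 0 ->
  0 < r < rho -> 0 < v * X r -> `|v| <= `|X r| ->
  exists2 s, 0 < s <= r & X s = v.
Proof.
move=> cX X0 /andP[r0 rr] pos le_v.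
have cw : {within `[0, r], continuous X}.
  apply: continuous_in_subspaceT => s; rewrite inE /= in_itv /= => /andP[s0 sr].
  by apply: cX; rewrite ger0_norm //; exact: le_lt_trans rr.
have [|s] := IVT (ltW r0) cw (v := v).
  rewrite X0; case: (ltgtP 0 (X r)) => hX.
  - have v0 : 0 < v by rewrite -(pmulr_lgt0 _ hX).
    by rewrite ltW //=; rewrite !gtr0_norm in le_v.
  - have v0 : v < 0 by rewrite -(nmulr_lgt0 _ hX).
    by rewrite (ltW v0) andbT; move: le_v; rewrite !ltr0_norm // lerN2.
  - by move: pos; rewrite -hX mulr0 ltxx.
rewrite in_itv /= => /andP[s0 sr] Xs; exists s => //; rewrite sr andbT lt_neqAle s0 andbT.
by apply/eqP => e; move: pos; rewrite -Xs -e X0 mul0r ltxx.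
Qed.

(** If both were on the same side of 0, the one that has gone farther would have
    passed through the position of the other. *)
Lemma opposite_sides (X Y : R -> R) (rho : R) :
  (forall s, `|s| < rho -> {for s, continuous X}) ->
  (forall s, `|s| < rho -> {for s, continuous Y}) ->
  X 0 = 0 -> Y 0 = 0 ->
  (forall r s, 0 < r < rho -> 0 < s < rho -> X r <> Y s) ->
  (forall r, 0 < r < rho -> X r <> 0) -> (forall r, 0 < r < rho -> Y r <> 0) ->
  forall r s, 0 < r < rho -> 0 < s < rho -> X r * Y s < 0.
Proof.
move=> cX cY X0 Y0 XY Xn Yn r s hr hs.
rewrite ltNge; apply/negP => pos.
have {}pos : 0 < X r * Y s.
  by rewrite lt_neqAle pos andbT eq_sym mulf_eq0; apply/norP; split; apply/eqP; [exact: Xn|exact: Yn].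
case: (leP `|X r| `|Y s|) => [le_XY|/ltW le_YX].
  have [c /andP[c0 cs] Yc] := germ_IVT cY Y0 hs pos le_XY.
  by apply: (XY r c) => //; rewrite c0 (le_lt_trans cs) //; case/andP: hs.
rewrite mulrC in pos.
have [c /andP[c0 cs] Yc] := germ_IVT cX X0 hr pos le_YX.
by apply: (XY c s) => //; rewrite c0 (le_lt_trans cs) //; case/andP: hr.
Qed.

(** The two half-branches along the second axis fill a neighbourhood of the
    origin in that axis. A small circular arc from one half-branch along the
    first axis to the other has to cross the second axis by the intermediate
    value theorem, hence meets one of them. *)
Lemma rays_alternate (T : plane -> plane) (rho a b a' b' : R) :
  0 < rho ->
  (forall p, p.1 ^+ 2 + p.2 ^+ 2 < rho ^+ 2 -> {for p, continuous T}) ->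
  (forall p q, p.1 ^+ 2 + p.2 ^+ 2 < rho ^+ 2 ->
     q.1 ^+ 2 + q.2 ^+ 2 < rho ^+ 2 -> T p = T q -> p = q) ->
  T (0, 0) = (0, 0) ->
  (forall r, 0 < r < rho -> (T (polar (0, 0) r a)).2 = 0) ->
  (forall r, 0 < r < rho -> (T (polar (0, 0) r b)).2 = 0) ->
  (forall r, 0 < r < rho -> (T (polar (0, 0) r a')).1 = 0) ->
  (forall r, 0 < r < rho -> (T (polar (0, 0) r b')).1 = 0) ->
  0 <= a -> a < b -> b < 2 * pi -> 0 <= a' < 2 * pi -> 0 <= b' < 2 * pi ->
  a' <> b' -> ~ (a <= a' <= b) -> ~ (a <= b' <= b) -> False.
Proof.
move=> rho0 cT iT T0 Ta Tb Ta' Tb' a0 ab b2 ha' hb' ab' na' nb'.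
have inB r c : `|r| < rho ->
    (polar (0, 0) r c).1 ^+ 2 + (polar (0, 0) r c).2 ^+ 2 < rho ^+ 2.
  by move=> hr; rewrite polar_norm -real_normK ?num_real // ltrXn2r // ltW.
have pos_norm r : 0 < r < rho -> `|r| < rho by move=> /andP[h1 h2]; rewrite gtr0_norm.
have polar0 c : polar (0, 0) 0 c = (0, 0) :> plane by rewrite /polar !mul0r !addr0.
have cont1 c s : `|s| < rho -> {for s, continuous (fun r => (T (polar (0, 0) r c)).1)}.
  move=> hs; apply: (@continuous_comp _ _ _ (fun r => T (polar (0,0) r c)) (fun p => p.1)); last exact: continuous_fst_at.
  apply: (@continuous_comp _ _ _ (fun r => polar (0,0) r c) T); first exact: continuous_polar_radius.
  exact/cT/inB.
have cont2 c s : `|s| < rho -> {for s, continuous (fun r => (T (polar (0, 0) r c)).2)}.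
  move=> hs; apply: (@continuous_comp _ _ _ (fun r => T (polar (0,0) r c)) (fun p => p.2)); last exact: continuous_snd_at.
  apply: (@continuous_comp _ _ _ (fun r => polar (0,0) r c) T); first exact: continuous_polar_radius.
  exact/cT/inB.
have inj r s c d : 0 < r < rho -> 0 < s < rho ->
    T (polar (0, 0) r c) = T (polar (0, 0) s d) -> 0 <= c < 2 * pi -> 0 <= d < 2 * pi -> c = d.
  move=> hr hs E hc hd.
  have [| |_ ca sa] := polar_inj _ _ (iT _ _ (inB _ _ (pos_norm _ hr)) (inB _ _ (pos_norm _ hs)) E).
  - by case/andP: hr. - by case/andP: hs.
  exact: angle_uniq.
have nz r c : 0 < r < rho -> T (polar (0, 0) r c) <> (0, 0).
  move=> hr Tr; have h0 : `|0 : R| < rho by rewrite normr0.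
  have Er : T (polar (0, 0) r c) = T (polar (0, 0) 0 c) by rewrite Tr polar0 T0.
  have /(congr1 (fun p => p.1 ^+ 2 + p.2 ^+ 2)) := iT _ _ (inB _ _ (pos_norm _ hr)) (inB _ _ h0) Er.
  rewrite !polar_norm expr0n /= => /eqP; rewrite sqrf_eq0 => /eqP r0.
  by move: hr; rewrite r0 ltxx.
have eq_pair (p : plane) x y : p.1 = x -> p.2 = y -> p = (x, y) by case: p => ? ? /= -> ->.
have ha : 0 <= a < 2 * pi by rewrite a0 (lt_trans ab).
have hb : 0 <= b < 2 * pi by rewrite b2 (le_trans a0) // ltW.
pose X c r := (T (polar (0, 0) r c)).1; pose Y c r := (T (polar (0, 0) r c)).2.
have eq2 (p q : plane) : p.1 = q.1 -> p.2 = q.2 -> p = q by case: p q => ? ? [? ?] /= -> ->.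
have X0 c : X c 0 = 0 by rewrite /X polar0 T0.
have Y0 c : Y c 0 = 0 by rewrite /Y polar0 T0.
have hX : forall r s, 0 < r < rho -> 0 < s < rho -> X a r * X b s < 0.
  apply: (opposite_sides (cont1 a) (cont1 b) (X0 a) (X0 b)).
  - move=> r s hr hs E; have : a = b; last by move=> e; move: ab; rewrite e ltxx.
    by apply: (inj r s) => //; apply: eq2 => //; rewrite Ta // Tb.
  - by move=> r hr E; apply: (nz r a hr); apply: eq_pair => //; exact: Ta.
  - by move=> r hr E; apply: (nz r b hr); apply: eq_pair => //; exact: Tb.
have hY : forall r s, 0 < r < rho -> 0 < s < rho -> Y a' r * Y b' s < 0.
  apply: (opposite_sides (cont2 a') (cont2 b') (Y0 a') (Y0 b')).
  - move=> r s hr hs E; have : a' = b'; last by [].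
    by apply: (inj r s) => //; apply: eq2 => //; rewrite Ta' // Tb'.
  - by move=> r hr E; apply: (nz r a' hr); apply: eq_pair => //; exact: Ta'.
  - by move=> r hr E; apply: (nz r b' hr); apply: eq_pair => //; exact: Tb'.
(* every small nonzero height on the second axis is attained by one of the two
   half-branches along it *)
pose r1 := rho / 2.
have hr1 : 0 < r1 < rho by rewrite /r1; apply/andP; split; lra.
pose C := Num.min `|Y a' r1| `|Y b' r1|.
have C0 : 0 < C.
  have := hY r1 r1 hr1 hr1; rewrite lt_min !normr_gt0 => h.
  by apply/andP; split; apply/eqP => e; move: h; rewrite e ?mul0r ?mulr0 ltxx.
have cover y : y != 0 -> `|y| < C -> exists2 r, 0 < r < rho & Y a' r = y \/ Y b' r = y.
  move=> y0; rewrite lt_min => /andP[/ltW h1 /ltW h2].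
  have [r11 r12] := andP hr1.
  have := hY r1 r1 hr1 hr1; case: (ltP 0 (y * Y a' r1)) => [pos _|neg h].
    have [s /andP[s0 sr] e] := germ_IVT (cont2 a') (Y0 a') hr1 pos h1.
    by exists s; [rewrite s0 (le_lt_trans sr)|left].
  have pos : 0 < y * Y b' r1.
    have Yb0 : Y b' r1 != 0 by apply/eqP => e; move: h; rewrite e mulr0 ltxx.
    rewrite lt_neqAle eq_sym mulf_neq0 //=; nra.
  have [s /andP[s0 sr] e] := germ_IVT (cont2 b') (Y0 b') hr1 pos h2.
  by exists s; [rewrite s0 (le_lt_trans sr)|right].
have [e e0 He] : exists2 e : R, 0 < e & forall r t, `|r| < e -> `|(T (polar (0,0) r t)).2| < C.
  apply: (@polar_near _ (0, 0) [set p | `|(T p).2| < C]).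
  have c0 : {for ((0, 0) : plane), continuous (fun p => (T p).2)}.
    apply: (@continuous_comp _ _ _ T (fun p => p.2)); last exact: continuous_snd_at.
    by apply: cT; rewrite /= expr0n addr0 exprn_gt0.
  move: c0; rewrite /prop_for /continuous_at T0 /= => /cvgr0_norm_lt/(_ C C0); exact.
pose r0 := Num.min e rho / 2.
have me : 0 < Num.min e rho by rewrite lt_min e0.
have hr0 : 0 < r0 < rho.
  have : Num.min e rho <= rho by rewrite ge_min lexx orbT.
  by rewrite /r0 => ?; apply/andP; split; lra.
have r0e : `|r0| < e.
  have : Num.min e rho <= e by rewrite ge_min lexx.
  by rewrite gtr0_norm /r0; lra.
have cw : {within `[a, b], continuous (fun c => (T (polar (0, 0) r0 c)).1)}.
  apply: continuous_subspaceT => c.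
  apply: (@continuous_comp _ _ _ (fun c => T (polar (0,0) r0 c)) (fun p => p.1)); last exact: continuous_fst_at.
  apply: (@continuous_comp _ _ _ (fun c => polar (0,0) r0 c) T); first exact: continuous_polar_angle.
  exact/cT/inB/pos_norm.
have [|c] := IVT (ltW ab) cw (v := 0).
  have := hX r0 r0 hr0 hr0; rewrite /X.
  set x := (T _).1; set y := (T _).1 => xy.
  by rewrite ge_min le_max; case: (leP x 0) => x0; case: (leP y 0) => y0 //=; nra.
rewrite in_itv /= => hc Tc.
have hc2 : 0 <= c < 2 * pi by case/andP: hc => h1 h2; apply/andP; split; lra.
have y0 : (T (polar (0, 0) r0 c)).2 != 0.
  by apply/eqP => y0; apply: (nz r0 c hr0); exact: eq_pair.
have [r hr [E|E]] := cover _ y0 (He _ _ r0e).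
  apply: na'; rewrite (_ : a' = c) //; apply: (inj r r0) => //.
  by apply: eq2 => //; rewrite Ta' // Tc.
apply: nb'; rewrite (_ : b' = c) //; apply: (inj r r0) => //.
by apply: eq2 => //; rewrite Tb' // Tc.
Qed.

End Transversality.

(** * Parity in cyclic words *)

Section CyclicWords.
Local Open Scope nat_scope.

Lemma sum_bool_card (L : finType) (P : pred L) : \sum_x P x = #|P|.
Proof. by rewrite -sum1_card [RHS]big_mkcond; apply: eq_bigr => x _; rewrite unfold_in; case: (P x). Qed.

Lemma sum_between p q M : \sum_(0 <= i < M) (p < i < q) = minn M q - p.+1.
Proof.
elim: M => [|M IH]; first by rewrite big_nil min0n.
by rewrite big_nat_recr //= IH; lia.
Qed.

Lemma odd_sum_changes (e : nat -> bool) m :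
  odd (\sum_(j < m) (e j (+) e j.+1)) = e 0 (+) e m.
Proof.
elim: m => [|m IH]; first by rewrite big_ord0 addbb.
by rewrite big_ord_recr /= oddD IH oddb addbA addbK.
Qed.

(** In a cyclic word of length [2 m] whose letters change after half a turn,
    the falls of one half are the rises of the other; so the falls number as
    many as the changes between antipodal places. *)
Lemma odd_falls (e : nat -> bool) m : (forall j, e (m + j) = ~~ e j) ->
  odd (\sum_(j < m + m) (e j && ~~ e j.+1)).
Proof.
move=> eN; rewrite big_split_ord /= -big_split /=.
rewrite (eq_bigr (fun j : 'I_m => (e j (+) e j.+1) : nat)) => [|j _].
  by have := eN 0; rewrite odd_sum_changes addn0 => ->; rewrite addbN addbb.
by rewrite -addnS !eN; case: (e j); case: (e j.+1).
Qed.

(** A pair of flags of one branch separates the two flags of every other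
    branch, so that equally many flags lie on both sides: the two flags of a
    branch are antipodal. *)
Lemma odd_outgoing_followed_by_incoming (L : finType) (pos : L * bool -> nat)
    (rot : L * bool -> L * bool) :
  0 < #|L| ->
  (forall phi, pos phi < #|L| + #|L|) ->
  (forall phi, pos (rot phi) = (pos phi).+1 %% (#|L| + #|L|)) ->
  (forall l l' b b', l != l' -> pos (l, b) < pos (l, ~~ b) -> pos (l', b') != pos (l', ~~ b') ->
     ~~ (pos (l, b) <= pos (l', b') <= pos (l, ~~ b)) ->
     ~~ (pos (l, b) <= pos (l', ~~ b') <= pos (l, ~~ b)) -> False) ->
  odd #|[pred l | ~~ (rot (l, true)).2]|.
Proof.
set m := #|L| => m0 pos_lt pos_rot alt.
have mm0 : 0 < m + m by rewrite addn_gt0 m0.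
have pos_iter i phi : pos (iter i rot phi) = (pos phi + i) %% (m + m).
  elim: i => [|i IH]; first by rewrite addn0 modn_small.
  by rewrite iterS pos_rot IH -addn1 modnDml addn1 addnS.
have /card_gt0P[l0 _] : 0 < #|L| by [].
pose phi0 : L * bool := (l0, true).
pose posI phi : 'I_(m + m) := Ordinal (pos_lt phi).
have cardLB : #|{: L * bool}| = m + m by rewrite card_prod card_bool muln2 addnn.
have posI_surj (i : 'I_(m + m)) : exists phi, posI phi = i.
  exists (iter (i + (m + m - pos phi0)) rot phi0); apply/val_inj; rewrite /= pos_iter.
  by rewrite addnCA subnKC ?modnDr ?modn_small //; exact: ltnW.
have posI_inj : injective posI.
  have /image_injP : #|fintype.image posI {: L * bool}| == #|{: L * bool}|.
    rewrite cardLB -[X in _ == X]card_ord; apply/eqP/eq_card => i.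
    by have [phi <-] := posI_surj i; rewrite fintype.image_f.
  by move=> inj x y; apply: inj.
have pos_inj : injective pos by move=> x y E; apply: posI_inj; exact/val_inj.
have posI_bij : bijective posI by apply: inj_card_bij => //; rewrite cardLB card_ord.
have pos_neq l b : pos (l, b) != pos (l, ~~ b).
  by apply/eqP => /pos_inj[]; case: b.
(* strictly between the two flags of [l] lies one flag of each other branch:
   with both or none, one of the two branches would not separate the other *)
have between l b : pos (l, b) < pos (l, ~~ b) -> forall l',
    (pos (l, b) < pos (l', true) < pos (l, ~~ b)) +
    (pos (l, b) < pos (l', false) < pos (l, ~~ b)) = (l' != l) :> nat.
  move=> lt l'; have [->|ne] := eqVneq l' l.
    by case: b lt => lt; rewrite !ltnn ?andbF.
  have strict b' : (pos (l, b) < pos (l', b') < pos (l, ~~ b)) =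
     (pos (l, b) <= pos (l', b') <= pos (l, ~~ b)).
    have h1 : pos (l, b) != pos (l', b') by apply: contraNneq ne => /pos_inj[-> _].
    have h2 : pos (l', b') != pos (l, ~~ b) by apply: contraNneq ne => /pos_inj[-> _].
    by rewrite !ltn_neqAle h1 h2.
  case: (boolP (pos (l, b) < pos (l', true) < _)) => inT;
    case: (boolP (pos (l, b) < pos (l', false) < _)) => inF //.
    exfalso; have neq' := pos_neq l' true; move: inT inF => /andP[t1 t2] /andP[f1 f2].
    case: (ltngtP (pos (l', true)) (pos (l', false))) => [lt'|lt'|/eqP]; last by rewrite (negbTE neq').
      apply: (alt l' l true b ne lt' (pos_neq l b)); apply/negP => /=; lia.
    apply: (alt l' l false b ne lt' (pos_neq l b)); apply/negP => /=; lia.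
  exfalso; apply: (alt l l' b true) => //; first by rewrite eq_sym.
    by rewrite -strict.
  by rewrite -strict.
have half l b : pos (l, b) < pos (l, ~~ b) -> pos (l, ~~ b) = pos (l, b) + m.
  move=> lt; have : \sum_(phi : L * bool) (pos (l, b) < pos phi < pos (l, ~~ b)) = m.-1.
    rewrite (eq_bigr (fun phi => (pos (l, b) < pos (phi.1, phi.2) < pos (l, ~~ b)) : nat)); last by case.
    rewrite -(pair_big predT predT (fun x y => (pos (l, b) < pos (x, y) < pos (l, ~~ b)) : nat)) /=.
    under eq_bigr => x _ do rewrite big_bool /= between //.
    rewrite (sum_bool_card (fun x => x != l)) /m -(cardC1 l).
    by apply: eq_card => x; rewrite !inE.
  have [g gK Kg] := posI_bij.
  rewrite (reindex g) /=; last by exists posI => x _; [exact: Kg|exact: gK].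
  have pos_g (i : 'I_(m + m)) : pos (g i) = i by rewrite -[RHS](congr1 val (Kg i)).
  under eq_bigr => i _ do rewrite pos_g.
  rewrite -(big_mkord predT (fun i => (pos (l, b) < i < pos (l, ~~ b)) : nat)) /=.
  have le2 : pos (l, ~~ b) <= m + m by exact: ltnW.
  rewrite sum_between; lia.
have antip phi : pos (phi.1, ~~ phi.2) = (pos phi + m) %% (m + m).
  case: phi => l b /=; case: (ltngtP (pos (l, b)) (pos (l, ~~ b))) => [lt|lt|/eqP].
  - by rewrite modn_small -half.
  - have := half l (~~ b); rewrite negbK => /(_ lt) ->.
    by rewrite -addnA modnDr modn_small.
  - by rewrite (negbTE (pos_neq l b)).
(* the signs of the flags in cyclic order *)
pose e j := (iter j rot phi0).2.
have eN j : e (m + j) = ~~ e j.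
  rewrite /e; suff -> : iter (m + j) rot phi0 = ((iter j rot phi0).1, ~~ (iter j rot phi0).2) by [].
  by apply: pos_inj; rewrite antip !pos_iter modnDml addnA addnAC.
have := odd_falls eN.
have it_inj : injective (fun j : 'I_(m + m) => iter j rot phi0).
  move=> i j /= /(congr1 pos); rewrite !pos_iter => /eqP.
  by rewrite eqn_modDl !modn_small // => /eqP/val_inj.
have it_bij : bijective (fun j : 'I_(m + m) => iter j rot phi0).
  by apply: inj_card_bij => //; rewrite cardLB card_ord.
rewrite (_ : \sum_(j < m + m) (e j && ~~ e j.+1) =
  \sum_(phi : L * bool) (phi.2 && ~~ (rot phi).2)); last first.
  rewrite [RHS](reindex (fun j : 'I_(m + m) => iter j rot phi0)) //.
  exact: onW_bij.
rewrite (eq_bigr (fun phi => (phi.2 && ~~ (rot (phi.1, phi.2)).2) : nat)); last by case.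
rewrite -(pair_big predT predT (fun x y => (y && ~~ (rot (x, y)).2) : nat)) /=.
under eq_bigr => x _ do rewrite big_bool /= addn0.
by rewrite (sum_bool_card (fun x => ~~ (rot (x, true)).2)).
Qed.

End CyclicWords.

(** * Words of curves are odd *)

Lemma card_image_finType (T : finType) (U : Type) (F : T -> U) :
  injective F -> (range F #= `I_#|T|)%card.
Proof.
move=> inj; have : {in [set: 'I_#|T|] &, injective (F \o enum_val)}.
  by move=> i j _ _ /= /inj/enum_val_inj.
have -> : range F = (F \o enum_val) @` [set: 'I_#|T|].
  apply/seteqP; split => y [u _ <-]; first by exists (enum_rank u) => //=; rewrite enum_rankK.
  by exists (enum_val u).
move=> /inj_card_eq h; apply: card_eq_trans h _.
have -> : `I_#|T| = (@nat_of_ord #|T|) @` [set: 'I_#|T|].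
  by apply/seteqP; split => i /=; [move=> lt; exists (Ordinal lt)|move=> [j _ <-]; exact: ltn_ord].
by rewrite card_eq_sym; apply: inj_card_eq => i j _ _; exact: val_inj.
Qed.

Section Necessity.
Variables (R : realType) (Sigma : surface R) (f : pointed_curve Sigma).
Notation plane := (R * R)%type.

(** Along a flag the curve sweeps a whole initial segment of its ray, by the
    intermediate value theorem for the distance to the centre of the star. *)
Lemma flag_sweeps_ray (a : Sigma) (m j : nat) V h g (phi : flag R) (Z : Sigma -> R) :
  star_nbhd f a m V h g -> S1 phi.1 -> f phi.1 = a -> flag_on_ray f h m j phi ->
  (\forall z \near within (@S1 R) (nbhs phi.1), Z (f z) = 0) ->
  exists2 e : R, 0 < e & forall r, 0 < r < e ->
    Z (g (polar (0, 0) r (j%:R * pi / m%:R))) = 0.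
Proof.
case: phi => x b /= [cV nV [[sVD sDV] [gK hK] ch cg] ha _] Sx fa onray near_Z.
have [cf _ _ _] := curve_tame f.
pose sgn s : R := if b then s else - s.
pose c s := f (turn x (sgn s)).
pose alpha : R := j%:R * pi / m%:R; rewrite -/alpha.
have S1c s : S1 (turn x (sgn s)) by exact: S1_turn.
have sgnc : continuous sgn.
  by rewrite /sgn; case: (b) => s; [exact: cvg_id|exact: opp_continuous].
have turnc s (A : set plane) : nbhs (turn x (sgn s)) A -> \forall t \near s, A (turn x (sgn t)).
  move=> hA; apply: (@continuous_comp _ _ _ sgn (fun t => turn x t)) hA; first exact: sgnc.
  exact: continuous_turn_angle.
have cc s (A : set Sigma) : nbhs (c s) A -> \forall t \near s, A (c t).
  move=> hA; move/subspace_continuousP: cf => /(_ _ (S1c s) _ hA) /= /turnc.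
  by apply: filterS => t; apply; exact: S1c.
have x0 : turn x (sgn 0) = x by rewrite /sgn oppr0 if_same turn0.
have c0 : c 0 = a by rewrite /c x0.
have nV0 : \forall t \near 0, V (c t) by apply: cc; rewrite c0.
have nZ0 : \forall t \near 0, Z (c t) = 0.
  move: near_Z; rewrite /within /= -{1}x0 => /turnc.
  by apply: filterS => t; apply; exact: S1c.
have onray' : \forall s \near 0^'+, exists2 r, 0 < r & h (c s) = polar (0, 0) r alpha.
  by apply: filterS onray => s; rewrite /c /sgn; case: (b).
have near3 : \forall s \near 0, [/\ V (c s), Z (c s) = 0 & 0 < s ->
    exists2 r, 0 < r & h (c s) = polar (0, 0) r alpha].
  move: onray'; rewrite /at_right /within /= => onray'.
  by near=> s; split; near: s.
move: near3 => /nbhs_ballP[e /= e0 He].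
pose s0 := e / 2.
have s00 : 0 < s0 by rewrite divr_gt0.
have {}He s : 0 <= s <= s0 -> [/\ V (c s), Z (c s) = 0 & 0 < s ->
    exists2 r, 0 < r & h (c s) = polar (0, 0) r alpha].
  move=> /andP[h1 h2]; apply: He; rewrite /ball /= sub0r normrN ger0_norm //.
  by rewrite (le_lt_trans h2) // /s0 ltr_pdivrMr // ltr_pMr // ltr1n.
(* the distance to the centre of the star *)
pose rho s := (h (c s)).1 * cos alpha + (h (c s)).2 * sin alpha.
have rhoE r s : h (c s) = polar (0, 0) r alpha -> rho s = r.
  move=> E; rewrite /rho E /polar /= !add0r -!mulrA -mulrDr -!expr2 cos2Dsin2 mulr1 //.
have rho0 : rho 0 = 0 by rewrite /rho c0 ha !mul0r addr0.
have crho : {within `[0, s0], continuous rho}.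
  apply/subspace_continuousP => s; rewrite /= in_itv /= => hs.
  have hcs : (h \o c) @ within `[0, s0] (nbhs s) --> h (c s).
    move=> A /= hA; have [Vs _ _] := He s hs.
    move/subspace_continuousP: ch => /(_ _ Vs _ hA) /= /cc.
    apply: filterS => t Ht; rewrite /= in_itv /= => ht.
    by have [Vt _ _] := He t ht; exact: Ht.
  apply: cvgD; apply: cvgM; try exact: cvg_cst.
    by apply: (continuous_cvg _ _ hcs); exact: continuous_fst_at.
  by apply: (continuous_cvg _ _ hcs); exact: continuous_snd_at.
have [_ _ /(_ s00)[r0 r00 Er0]] := He s0 (introT andP (conj (ltW s00) (lexx s0))).
exists r0 => // r /andP[rp rr0].
have [|s] := IVT (ltW s00) crho (v := r).
  by rewrite rho0 (rhoE _ _ Er0) ge_min le_max (ltW rp) (ltW rr0) orbT.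
rewrite in_itv /= => hs Es.
have sp : 0 < s.
  rewrite lt_neqAle andbC; case/andP: hs => -> _ /=; apply/eqP => e1.
  by move: rp; rewrite -Es -e1 rho0 ltxx.
have [Vs Zs /(_ sp)[r' _ Er']] := He s hs.
have rr' : r = r' by rewrite -Es; exact: rhoE.
by rewrite rr' -Er' gK.
Unshelve. all: by end_near. Qed.

(** The change of coordinates from the star to the cross of the two branches
    turns the flags of one branch into the horizontal half-axes and those of
    the other into the vertical ones. *)
Lemma branches_alternate (a : Sigma) (m : nat) V h g x y (b b' : bool) (p q p' q' : nat) :
  self_transversal f -> crossings f a -> (0 < m)%N ->
  star_nbhd f a m V h g -> S1 x -> S1 y -> x <> y -> f x = a -> f y = a ->
  flag_on_ray f h m p (x, b) -> flag_on_ray f h m q (x, ~~ b) ->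
  flag_on_ray f h m p' (y, b') -> flag_on_ray f h m q' (y, ~~ b') ->
  (p < q)%N -> p' != q' -> (q < m + m)%N -> (p' < m + m)%N -> (q' < m + m)%N ->
  ~~ (p <= p' <= q)%N -> ~~ (p <= q' <= q)%N -> False.
Proof.
move=> st cra m0 sn Sx Sy xy fx fy on1 on2 on3 on4 pq pq' q2 p2' q2' n1 n2.
have [N [k [l [nN [[sN _] [lK _] ck _] nx ny]]]] := st a x y cra Sx Sy xy fx fy.
have Zx : \forall z \near within (@S1 R) (nbhs x), (k (f z)).2 = 0.
  by apply: filterS nx => z [].
have Zy : \forall z \near within (@S1 R) (nbhs y), (k (f z)).1 = 0.
  by apply: filterS ny => z [].
have [e1 e10 H1] := flag_sweeps_ray (Z := fun z => (k z).2) (phi := (x, b)) sn Sx fx on1 Zx.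
have [e2 e20 H2] := flag_sweeps_ray (Z := fun z => (k z).2) (phi := (x, ~~ b)) sn Sx fx on2 Zx.
have [e3 e30 H3] := flag_sweeps_ray (Z := fun z => (k z).1) (phi := (y, b')) sn Sy fy on3 Zy.
have [e4 e40 H4] := flag_sweeps_ray (Z := fun z => (k z).1) (phi := (y, ~~ b')) sn Sy fy on4 Zy.
have [_ nV [[sVD sDV] [gK hK] ch cg] ha _] := sn.
have Va : V a by exact: nbhs_singleton nV.
have g0 : g (0, 0) = a by rewrite -ha gK.
have disc_in z : z.1 ^+ 2 + z.2 ^+ 2 < 1 ^+ 2 -> @disc R z.
  by rewrite expr1n /disc /= => /ltW.
have gc u : u.1 ^+ 2 + u.2 ^+ 2 < 1 ^+ 2 -> {for u, continuous g}.
  move=> hp; have np : nbhs u (@disc R).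
    have cq : {for u, continuous (fun p : plane => p.1 ^+ 2 + p.2 ^+ 2)}.
      by apply: continuousD; apply: continuousM; first [exact: cvg_fst|exact: cvg_snd].
    move/(cvgr_lt): cq => /(_ _ hp); apply: filterS => z; exact: disc_in.
  move=> A hA; move/subspace_continuousP: cg => /(_ u (disc_in _ hp) A hA) /=.
  by rewrite /within /= => H; apply: filterS2 np H => z Dz; exact.
have [d d0 Hd] : exists2 d : R, 0 < d & forall p, p.1 ^+ 2 + p.2 ^+ 2 < d ^+ 2 -> nbhs (g p) N.
  apply: nbhs_disc; have : {for ((0,0) : plane), continuous g}.
    by apply: gc; rewrite /= expr0n /= addr0 exprn_gt0.
  move=> /(_ (interior N)); rewrite g0; apply; exact: nbhs_interior.
pose rho := Num.min d (Num.min 1 (Num.min (Num.min e1 e2) (Num.min e3 e4))).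
have rho0 : 0 < rho by rewrite !lt_min d0 ltr01 e10 e20 e30 e40.
have [rd r1 re1 [re2 re3 re4]] :
    [/\ rho <= d, rho <= 1, rho <= e1 & [/\ rho <= e2, rho <= e3 & rho <= e4]].
  by split; [| | |split]; rewrite !ge_min lexx ?orbT.
have sq_le (z c : R) : z < rho ^+ 2 -> rho <= c -> z < c ^+ 2.
  move=> hz hc; apply: lt_le_trans hz _; rewrite ler_sqr ?nnegrE //; lra.
have pi0 := pi_gt0 R.
have m0' : 0 < m%:R :> R by rewrite ltr0n.
have ang_lt (i j : nat) : (i < j)%N -> i%:R * pi / m%:R < j%:R * pi / m%:R :> R.
  by move=> ij; rewrite ltr_pM2r ?invr_gt0 // ltr_pM2r // ltr_nat.
have ang_le (i j : nat) : (i%:R * pi / m%:R <= j%:R * pi / m%:R :> R) = (i <= j)%N.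
  by rewrite ler_pM2r ?invr_gt0 // ler_pM2r // ler_nat.
have ang0 (i : nat) : 0 <= i%:R * pi / m%:R :> R.
  by rewrite divr_ge0 ?mulr_ge0 // ltW.
have ang2 (i : nat) : (i < m + m)%N -> i%:R * pi / m%:R < 2 * pi :> R.
  move=> /ang_lt lt; apply: lt_le_trans lt _.
  by rewrite natrD ler_pdivrMr // le_eqVlt; apply/orP; left; apply/eqP; ring.
apply: (@rays_alternate _ (k \o g) rho (p%:R * pi / m%:R) (q%:R * pi / m%:R)
  (p'%:R * pi / m%:R) (q'%:R * pi / m%:R)) => //.
- move=> z hz; have z1 := sq_le _ _ hz r1; have zd := sq_le _ _ hz rd.
  apply: continuous_comp; first exact: gc.
  move=> A hA; have Ng := Hd _ zd.
  move/subspace_continuousP: ck => /(_ _ (nbhs_singleton Ng) A hA) /=.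
  by rewrite /within /= => H; apply: filterS2 Ng H => w Nw; exact.
- move=> z w hz hw; have zN := nbhs_singleton (Hd _ (sq_le _ _ hz rd)).
  have wN := nbhs_singleton (Hd _ (sq_le _ _ hw rd)).
  move=> /(congr1 l) /=; rewrite !lK // => /(congr1 h).
  by rewrite !hK //; apply: disc_in; apply: sq_le r1.
- have kx : (k a).2 = 0 by move: Zx; rewrite /within /= => /nbhs_singleton/(_ Sx); rewrite fx.
  have ky : (k a).1 = 0 by move: Zy; rewrite /within /= => /nbhs_singleton/(_ Sy); rewrite fy.
  by rewrite /= g0; case: (k a) kx ky => ? ? /= -> ->.
- by move=> r /andP[h1 h2]; apply: H1; rewrite h1 (lt_le_trans h2).
- by move=> r /andP[h1 h2]; apply: H2; rewrite h1 (lt_le_trans h2).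
- by move=> r /andP[h1 h2]; apply: H3; rewrite h1 (lt_le_trans h2).
- by move=> r /andP[h1 h2]; apply: H4; rewrite h1 (lt_le_trans h2).
- exact: ang_lt.
- exact: ang2.
- by rewrite ang0 ang2.
- by rewrite ang0 ang2.
- move=> E; case: (ltngtP p' q') => [/ang_lt|/ang_lt|/eqP]; rewrite ?E ?ltxx //.
  by rewrite (negbTE pq').
- by rewrite !ang_le; apply/negP.
- by rewrite !ang_le; apply/negP.
Qed.

(** At each crossing the flags of the curve, with the flag rotation, form a
    cyclic word of the kind counted above. *)
Lemma realized_word_odd (E : finType) (W : word E) :
  self_transversal f -> realized_by W f -> odd_word W.
Proof.
move=> st [W' [t [rho [t02 tinc tsing tlet [rot mkW']]]] [eqn [mkW [psi psi_bij psiE]]]] k.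
case: W W' eqn mkW psiE t t02 tinc tsing tlet mkW' k => [n w S] [n' w' S'] /= eqn.
case: n' / eqn w' S' => w' S' mkW psiE t t02 tinc tsing tlet mkW' k.
have {}mkW l : (l \in S) = (l \in S') by rewrite mkW cast_ord_id.
have {}psiE l : psi (w l) = w' l by rewrite psiE cast_ord_id.
pose x l := turn (base f) (t l).
have S1x l : S1 (x l) by apply: S1_turn; exact: base_S1.
have t_inj : injective t.
  move=> l l' e; apply/val_inj; case: (ltngtP l l') => // /tinc; by rewrite e ltxx.
have x_inj : injective x.
  by move=> l l' /(turn_inj (base_S1 f) (t02 l) (t02 l')); exact: t_inj.
have x_sing l : sing f (x l) by rewrite -tsing; exists l.
pose a := f (x k).
have w_eq l : (w k == w l) = (f (x l) == a).
  have fx l' : f (x l') = set_val (psi (w l')) by rewrite -tlet psiE.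
  apply/eqP/eqP => [e|]; first by rewrite /a !fx e.
  by rewrite /a !fx => /val_inj/(bij_inj psi_bij).
have cra : cr f a by have [] := x_sing k.
have [m [V [h [g [[m0 sm cm] sn _ rotP]]]]] := rot a cra.
pose L : finType := {l : 'I_n | w k == w l}.
have fxL (l : L) : f (x (val l)) = a by apply/eqP; rewrite -w_eq; exact: valP l.
have mL : #|L| = m.
  apply/card_eq_II.
  have inj : injective (fun l : L => x (val l)) by move=> l l' /x_inj/val_inj.
  apply: card_eq_trans cm; rewrite card_eq_sym.
  rewrite (_ : _ `&` _ = range (fun l : L => x (val l))); first exact: card_image_finType.
  apply/seteqP; split => [z [Sz fz]|z [l _ <-]]; last by split=> //; exact: fxL.
  have : sing f z by split=> //; rewrite /= fz.
  rewrite -tsing => -[l _ zE]; have kl : w k == w l by rewrite w_eq; apply/eqP; rewrite -fz -zE.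
  by exists (exist _ l kl).
(* [rho] acts on the flags at [a], advancing them by one ray *)
pose fl (phi : L * bool) : flag R := (x (val phi.1), phi.2).
have /choice[next nextP] : forall phi, exists psi, rho (fl phi) = fl psi /\
    exists2 j, (j < m + m)%N & flag_on_ray f h m j (fl phi) /\ flag_on_ray f h m j.+1 (fl psi).
  move=> phi; have at_phi : flag_at f a (fl phi) by split; [exact: x_sing|exact: fxL].
  have [[sing_r f_r] [j [onj onj1]]] := rotP _ at_phi.
  move: (sing_r); rewrite -tsing => -[l _ lE].
  have kl : w k == w l by rewrite w_eq; apply/eqP; rewrite -f_r -lE.
  have rE : rho (fl phi) = fl (exist _ l kl, (rho (fl phi)).2).
    by rewrite {1}[rho _]surjective_pairing -lE.
  exists (exist _ l kl, (rho (fl phi)).2); split => //.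
  exists (j %% (m + m))%N; first by rewrite ltn_pmod // addn_gt0 m0.
  rewrite -rE /flag_on_ray (ray_mod R m0 (modn_mod _ _)).
  by rewrite (@ray_mod R m (j %% (m + m)).+1 j.+1) // -addn1 modnDml addn1.
have /choice[pos posP] : forall phi, exists j, (j < m + m)%N /\
    (flag_on_ray f h m j (fl phi) /\ flag_on_ray f h m j.+1 (fl (next phi))).
  by move=> phi; have [_ [j lt [h1 h2]]] := nextP phi; exists j.
have pos_uniq phi i j : flag_on_ray f h m i (fl phi) -> flag_on_ray f h m j (fl phi) ->
    i = j %[mod m + m].
  move=> hi hj; have [s [h1 h2]] := filter_ex (filterI hi hj).
  exact: ray_disjoint m0 h1 h2.
have odd_next : odd #|[pred l | ~~ (next (l, true)).2]|.
  apply: (odd_outgoing_followed_by_incoming (pos := pos)); rewrite ?mL //.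
  - by move=> phi; have [] := posP phi.
  - move=> phi; have [lt [on1 on2]] := posP phi; have [lt' [on1' _]] := posP (next phi).
    by rewrite (pos_uniq _ _ _ on2 on1') modn_small.
  - move=> l l' b b' ll' lt neq out1 out2.
    have xx : x (val l) <> x (val l') by move=> /x_inj/val_inj/eqP; rewrite (negbTE ll').
    have cra' : crossings f a.
      split; first by exists (x k).
      exists m; last by split.
      rewrite -mL ltnNge; apply/negP => le1; move/eqP: ll'; apply.
      exact: (fintype_le1P le1).
    have [lt1 [on1 _]] := posP (l, b); have [lt2 [on2 _]] := posP (l, ~~ b).
    have [lt3 [on3 _]] := posP (l', b'); have [lt4 [on4 _]] := posP (l', ~~ b').
    exact: (branches_alternate st cra' m0 sn (S1x _) (S1x _) xx (fxL l) (fxL l') on1 on2 on3 on4).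
rewrite (_ : #|_| = #|[pred l | ~~ (next (l, true)).2]|) //.
rewrite -(fintype.card_image val_inj); apply: eq_card => l; rewrite !inE.
have mk_next (l' : L) : (val l' \in S) = ~~ (next (l', true)).2.
  by rewrite mkW mkW'; have [E1 _] := nextP (l', true); rewrite -/(fl (l', true)) E1.
apply/andP/fintype.imageP => [[lS kl]|[l' nl' ->]].
  by exists (exist _ l kl); rewrite // inE -mk_next.
by split; [rewrite mk_next|exact: valP l'].
Qed.

End Necessity.

(** * Winding numbers and orientation *)

Section Orientation.
Variable R : realType.
Notation plane := (R * R)%type.
Implicit Types (p q : plane) (F : plane -> plane).

(** The angle between the loop and a rotated circle stays in (-pi/2, pi/2), where
    it is the arc tangent of a slope; added to the angle of the circle it gives a
    continuous angle of the loop. *)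
Lemma winding_of_positive (gamma : R -> plane) q (a : R) :
  continuous gamma -> gamma (2 * pi) = gamma 0 ->
  (forall t, 0 < ((gamma t).1 - q.1) * cos (t + a) + ((gamma t).2 - q.2) * sin (t + a)) ->
  winding gamma q 1.
Proof.
move=> cg per pos.
(* the coordinates of [gamma t - q] in the frame rotated by [t + a] *)
pose d t := ((gamma t).1 - q.1) * cos (t + a) + ((gamma t).2 - q.2) * sin (t + a).
pose c t := ((gamma t).2 - q.2) * cos (t + a) - ((gamma t).1 - q.1) * sin (t + a).
have cts (G : R -> R) : continuous G -> continuous (fun t => G (t + a)).
  move=> cG t; apply: continuous_comp; last exact: cG.
  by apply: continuousD; [exact: cvg_id|exact: cst_continuous].
have cc := cts _ (@continuous_cos R); have cs := cts _ (@continuous_sin R).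
have c1 : continuous (fun t => (gamma t).1 - q.1).
  move=> t; apply: cvgB; last exact: cvg_cst.
  exact: (cvg_comp _ _ (cg t) (@continuous_fst_at R (gamma t))).
have c2 : continuous (fun t => (gamma t).2 - q.2).
  move=> t; apply: cvgB; last exact: cvg_cst.
  exact: (cvg_comp _ _ (cg t) (@continuous_snd_at R (gamma t))).
have cd : continuous d by move=> t; apply: cvgD; apply: cvgM; [exact: c1|exact: cc|exact: c2|exact: cs].
have ccr : continuous c by move=> t; apply: cvgB; apply: cvgM; [exact: c2|exact: cc|exact: c1|exact: cs].
exists (fun t => t + a + atan (c t / d t)); split.
- apply: continuous_subspaceT => t; apply: cvgD.
    by apply: cvgD; [exact: cvg_id|exact: cvg_cst].
  apply: (@continuous_comp _ _ _ (fun t => c t / d t) (@atan R)); last exact: continuous_atan.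
  apply: cvgM; first exact: ccr.
  by apply: cvgV; [rewrite gt_eqF //; exact: pos|exact: cd].
- move=> t _; set A := atan _.
  have cA : 0 < cos A by apply: cos_gt0_pihalf; rewrite atan_gtNpi2 atan_ltpi2.
  have sA : sin A = c t / d t * cos A.
    by rewrite -[c t / d t]atanK /tan -/A divfK // gt_eqF.
  exists (d t / cos A); first by rewrite divr_gt0 //; exact: pos.
  have E1 : d t / cos A * cos A = d t by rewrite divfK // gt_eqF.
  have E2 : d t / cos A * sin A = c t.
    have dn : d t != 0 by rewrite gt_eqF //; exact: pos.
    by rewrite sA; field; rewrite dn gt_eqF.
  have h := cos2Dsin2 (t + a).
  move: h E1 E2; rewrite /polar; set B := t + a => h E1 E2.
  rewrite (cosD B) (sinD B) [gamma t]surjective_pairing; congr pair.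
    rewrite mulrBr [d t / cos A * (cos _ * _)]mulrCA E1 [d t / cos A * (sin _ * _)]mulrCA E2 /d /c -/B.
    by rewrite -[LHS](addrNK q.1) -[X in X + _]mulr1 -h; ring.
  rewrite mulrDr [d t / cos A * (sin _ * _)]mulrCA E1 [d t / cos A * (cos _ * _)]mulrCA E2 /d /c -/B.
  by rewrite -[LHS](addrNK q.2) -[X in X + _]mulr1 -h; ring.
have [cp sp] := cos_sin_period a 1.
rewrite mulr1z mulr1 in cp sp.
have -> : d (2 * pi) = d 0 by rewrite /d per [2 * pi + a]addrC cp sp add0r.
have -> : c (2 * pi) = c 0 by rewrite /c per [2 * pi + a]addrC cp sp add0r.
ring.
Qed.

Lemma turn_dot p q (a : R) :
  (turn p a).1 * (turn q a).1 + (turn p a).2 * (turn q a).2 = p.1 * q.1 + p.2 * q.2.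
Proof.
by rewrite /turn /=; rewrite -[RHS]mulr1 -(cos2Dsin2 a); ring.
Qed.

Lemma turnB p q (a : R) : turn (p - q) a = turn p a - turn q a.
Proof.
case: p q => [p1 p2] [q1 q2]; rewrite /turn /=.
change ((p1, p2) - (q1, q2)) with (p1 - q1, p2 - q2) => /=.
set x := (_, _); set y := (p1 * _ - _, _); set z := (_, _).
have -> : y - z = (y.1 - z.1, y.2 - z.2) by [].
by rewrite /x /y /z /=; congr pair; ring.
Qed.

Lemma preserves_near F G q : (\forall p \near q, F p = G p) ->
  preserves_orientation_at G q -> preserves_orientation_at F q.
Proof.
move=> FG; rewrite /preserves_orientation_at => pG.
have [e e0 He] := polar_near FG.
have Fq : F q = G q by exact: (nbhs_singleton FG).
near=> r.
have -> : (fun t => F (polar q r t)) = (fun t => G (polar q r t)).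
  apply/funext => t; apply: He.
  have r0 : 0 < r by near: r; exact: nbhs_right_gt.
  by rewrite gtr0_norm //; near: r; exact: nbhs_right_lt.
rewrite Fq; near: r; exact: pG.
Unshelve. all: by end_near. Qed.

(** Small circles around [q] are mapped to loops as in [winding_of_positive]. *)
Lemma preserves_of_positive F q (a : R) :
  (\forall p \near q, {for p, continuous F}) ->
  (\forall p \near q, p <> q -> 0 < ((F p).1 - (F q).1) * (turn (p - q) a).1 +
     ((F p).2 - (F q).2) * (turn (p - q) a).2) ->
  preserves_orientation_at F q.
Proof.
move=> cF posF.
have [e e0 He] := polar_near (filterI cF posF).
rewrite /preserves_orientation_at; near=> r.
have r0 : 0 < r by near: r; exact: nbhs_right_gt.
have re : `|r| < e by rewrite gtr0_norm //; near: r; exact: nbhs_right_lt.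
apply: (@winding_of_positive _ _ a).
- move=> t; apply: (@continuous_comp _ _ _ (fun t => polar q r t) F); first exact: continuous_polar_angle.
  by have [] := He r t re.
- have [c s] := cos_sin_period (0 : R) 1; rewrite mulr1z mulr1 add0r in c s.
  by rewrite /polar c s.
move=> t; have [_] := He r t re.
have E : polar q r t - q = turn (r, 0) t.
  by rewrite turn_axis /polar [LHS]surjective_pairing /=; congr pair; ring.
rewrite E turnD turn_axis /polar /= !add0r => H.
have pn : (q.1 + r * cos t, q.2 + r * sin t) <> q.
  rewrite -/(polar q r t).
  move=> /(congr1 (fun p => p - q)); rewrite E subrr => /(congr1 (fun p => p.1 ^+ 2 + p.2 ^+ 2)).
  rewrite turn_axis polar_norm /= expr0n addr0 => /eqP; rewrite sqrf_eq0 => /eqP E0.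
  by move: r0; rewrite E0 ltxx.
by have := H pn; rewrite mulrCA [X in _ + X]mulrCA -mulrDr pmulr_rgt0.
Unshelve. all: by end_near. Qed.

Lemma preserves_id F q : (\forall p \near q, F p = p) -> preserves_orientation_at F q.
Proof.
move=> Fid; apply: (preserves_near (G := id)) => //.
apply: (preserves_of_positive (a := 0)); first by near=> p; exact: cvg_id.
near=> p => pq; rewrite turn0 /= -!expr2.
rewrite lt_neqAle eq_sym paddr_eq0 ?sqr_ge0 // !sqrf_eq0 !subr_eq0 addr_ge0 ?sqr_ge0 // andbT.
by apply/andP => -[/eqP h1 /eqP h2]; apply: pq; case: (p) (q) h1 h2 => ? ? [? ?] /= -> ->.
Unshelve. all: by end_near. Qed.

Lemma preserves_translate F q (c d : plane) : preserves_orientation_at F (q + c) ->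
  preserves_orientation_at (fun p => F (p + c) - d) q.
Proof.
rewrite /preserves_orientation_at; apply: filterS => r [theta [ct Hr per]].
exists theta; split=> // t /Hr[s s0 E]; exists s => //.
have -> : polar q r t + c = polar (q + c) r t.
  by rewrite /polar [LHS]surjective_pairing /=; congr pair; ring.
by rewrite E /polar [LHS]surjective_pairing /=; congr pair; ring.
Qed.

(** The change of coordinate [u = -1/x]: it sends the two ends of the [x]-axis
    to the two sides of [u = 0]. As the inverse of 0 is 0, it is an involution
    of the whole plane. *)
Definition flip p : plane := (- p.1^-1, p.2).

Lemma flipK : involutive flip.
Proof. by case=> x y; rewrite /flip /= invrN opprK invrK. Qed.

Lemma continuous_flip p : p.1 != 0 -> {for p, continuous flip}.
Proof.
move=> p0; apply: continuous_plane; last exact: cvg_snd.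
by apply: continuousN; apply: continuousV => //; exact: cvg_fst.
Qed.

Lemma flip_lt0 p : ((flip p).1 < 0) = (0 < p.1).
Proof. by rewrite /= oppr_lt0 invr_gt0. Qed.

Lemma flip_gt0 p : (0 < (flip p).1) = (p.1 < 0).
Proof. by rewrite /= oppr_gt0 invr_lt0. Qed.

Lemma flip_eq0 p : ((flip p).1 == 0) = (p.1 == 0).
Proof. by rewrite /= oppr_eq0 invr_eq0. Qed.

(** On either side of the second axis [flip] is increasing in each coordinate,
    which gives the positivity required above. *)
Lemma preserves_turn_flip F q (a b : R) : (turn q b).1 != 0 ->
  (\forall p \near q, F p = turn (flip (turn p b)) a) -> preserves_orientation_at F q.
Proof.
move=> q0 /preserves_near; apply.
have near_pos : \forall p \near q, 0 < (turn p b).1 * (turn q b).1.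
  have : {for q, continuous (fun p => (turn p b).1 * (turn q b).1)}.
    apply: continuousM; last exact: cst_continuous.
    by apply: continuous_comp; [exact: continuous_turn|exact: continuous_fst_at].
  by move/cvgr_gt; apply; rewrite -expr2 exprn_even_gt0.
apply: (preserves_of_positive (a := b + a)).
  near=> p.
  apply: (@continuous_comp _ _ _ (fun p => flip (turn p b)) (fun p => turn p a)); last exact: continuous_turn.
  apply: (@continuous_comp _ _ _ (fun p => turn p b) flip); first exact: continuous_turn.
  apply: continuous_flip; apply/eqP => p0.
  have : 0 < (turn p b).1 * (turn q b).1 by near: p.
  by rewrite p0 mul0r ltxx.
near=> p => pq.
have pos : 0 < (turn p b).1 * (turn q b).1 by near: p.
rewrite -turnD; set p' := turn p b; set q' := turn q b in q0 pos *.
have -> (x y : plane) : x.1 - y.1 = (x - y).1 by [].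
have -> (x y : plane) : x.2 - y.2 = (x - y).2 by [].
rewrite -turnB turn_dot turnB -/p' -/q' /=.
have p0 : p'.1 != 0 by apply: contraTneq pos => ->; rewrite mul0r ltxx.
have -> : (- p'.1^-1 - - q'.1^-1) * (p'.1 - q'.1) = (p'.1 - q'.1) ^+ 2 / (p'.1 * q'.1).
  by field; rewrite p0 q0.
have pq' : (p'.1 != q'.1) || (p'.2 != q'.2).
  rewrite -negb_and; apply/negP => /andP[/eqP h1 /eqP h2]; apply: pq.
  apply: (can_inj (turnK b)); rewrite -/p' -/q'.
  by rewrite [LHS]surjective_pairing [RHS]surjective_pairing h1 h2.
case/orP: pq' => h.
  by apply: ltr_pwDl; rewrite -?expr2 ?sqr_ge0 // divr_gt0 // exprn_even_gt0 //= subr_eq0.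
apply: ltr_wpDl; first by rewrite divr_ge0 ?sqr_ge0 // ltW.
by rewrite -expr2 exprn_even_gt0 //= subr_eq0.
Unshelve. all: by end_near. Qed.

End Orientation.

(** * Open embeddings of the plane *)

Section Embeddings.

Lemma near_cvg (X Y : topologicalType) (f g : X -> Y) x :
  (\forall y \near x, f y = g y) -> {for x, continuous f} -> {for x, continuous g}.
Proof.
move=> fg cf A nA; have fx : f x = g x by exact: (nbhs_singleton fg).
rewrite -fx in nA; have /= := cf A nA; apply: filterS2 fg => y E1 /=.
by rewrite -E1.
Qed.

Lemma continuous_left_inverse (X Y : topologicalType) (g : X -> Y) (h : Y -> X) (D : set X) :
  (forall O, open O -> open (g @` O)) -> open D -> (forall x, D x -> h (g x) = x) ->
  forall x, D x -> {for g x, continuous h}.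
Proof.
move=> og oD hg x Dx A; rewrite hg // => nA.
have : nbhs x (A `&` D) by apply: filterI => //; exact: open_nbhs_nbhs.
rewrite nbhsE => -[B [oB Bx] BAD].
apply: (@filterS _ _ _ (g @` B)).
  by move=> _ [z Bz <-] /=; have [Az Dz] := BAD z Bz; rewrite hg.
by apply: open_nbhs_nbhs; split; [exact: og|exists x].
Qed.

Lemma homeo_on_image (X Y : topologicalType) (g : X -> Y) (h : Y -> X) (D : set X) :
  {within D, continuous g} -> (forall x, D x -> h (g x) = x) ->
  {within g @` D, continuous h} -> homeo_on (g @` D) D h g.
Proof.
move=> cg hg ch; split => //; split.
- by move=> _ [x Dx <-]; rewrite /= hg.
- by move=> x Dx; exists x.
- by move=> _ [x Dx <-]; rewrite hg.
- exact: hg.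
Qed.

Lemma homeo_on_open_image (X Y : topologicalType) (g : X -> Y) (h : Y -> X) (D : set X) :
  continuous g -> (forall O, open O -> open (g @` O)) -> open D ->
  (forall x, D x -> h (g x) = x) -> homeo_on (g @` D) D h g.
Proof.
move=> cg og oD hg; apply: homeo_on_image => //; first exact: continuous_subspaceT.
apply: continuous_in_subspaceT => _ /set_mem [x Dx <-].
exact: continuous_left_inverse Dx.
Qed.

Variable R : realType.
Notation plane := (R * R)%type.

Lemma compact_disc : compact (@disc R).
Proof.
apply: (@subclosed_compact _ _ ((`[-1, 1]%classic : set R) `*` (`[-1, 1]%classic : set R))).
- apply: (@closed_comp _ _ (fun p : plane => p.1 ^+ 2 + p.2 ^+ 2) [set x | x <= 1]); last exact: closed_le.
  by move=> p _; apply: cvgD; apply: cvgM; first [exact: cvg_fst|exact: cvg_snd].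
- by apply: compact_setX; exact: segment_compact.
move=> p; rewrite /disc /= => h; rewrite !in_itv /=.
have h1 := sqr_ge0 p.1; have h2 := sqr_ge0 p.2.
by split; apply/andP; split; nra.
Qed.

Lemma plane_countable_base : exists2 B : set (set plane), countable B &
  (forall O, B O -> open O) /\
  forall q A, nbhs q A -> exists O, [/\ B O, O q & O `<=` A].
Proof.
pose box (i : (rat * rat) * (rat * rat)) : set plane :=
  [set p | ratr i.1.1 < p.1 < ratr i.1.2 /\ ratr i.2.1 < p.2 < ratr i.2.2].
exists (range box).
  exact: sub_countable (card_image_le _ _) (countableP _).
split.
  move=> _ [[[a b] [c d]] _ <-].
  rewrite (_ : box _ = [set p : plane | p.1 \in `]ratr a, ratr b[] `&` [set p | p.2 \in `]ratr c, ratr d[]).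
    apply: openI.
      apply: (@open_comp plane R (fun p => p.1) [set` `]ratr a, ratr b[]); last exact: interval_open.
      by move=> p _; exact: cvg_fst.
    apply: (@open_comp plane R (fun p => p.2) [set` `]ratr c, ratr d[]); last exact: interval_open.
    by move=> p _; exact: cvg_snd.
  by apply/seteqP; split => p /=; rewrite !in_itv.
move=> q A /nbhs_box[e e0 H].
have lt1 (x : R) : x - e < x by rewrite ltrBlDr ltrDl.
have lt2 (x : R) : x < x + e by rewrite ltrDl.
have [a] := rat_in_itvoo (lt1 q.1); have [b] := rat_in_itvoo (lt2 q.1).
have [c] := rat_in_itvoo (lt1 q.2); have [d] := rat_in_itvoo (lt2 q.2).
rewrite !in_itv /= => /andP[d1 d2] /andP[c1 c2] /andP[b1 b2] /andP[a1 a2].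
exists (box ((a, b), (c, d))); split; first by exists ((a, b), (c, d)).
  by rewrite /box /= a2 b1 c2 d1.
move=> p [/= /andP[h1 h2] /andP[h3 h4]]; apply: H; rewrite ltr_distl.
  by rewrite (lt_trans a1 h1) (lt_trans h2).
by rewrite (lt_trans c1 h3) (lt_trans h4).
Qed.

Lemma de_Moivre (r t : R) n :
  (Complex (r * cos t) (r * sin t)) ^+ n = Complex (r ^+ n * cos (n%:R * t)) (r ^+ n * sin (n%:R * t)).
Proof.
elim: n => [|n IH]; first by rewrite !expr0 mul0r cos0 sin0 mulr1 mulr0.
rewrite exprS IH exprS -natr1 mulrDl mul1r cosD sinD.
by apply/eqP; rewrite eq_complex /=; apply/andP; split; apply/eqP; ring.
Qed.

Lemma sin_eq0 (x : R) : sin x = 0 -> exists z : int, x = z%:~R * pi.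
Proof.
move=> s0; have := sin0cos1 s0.
case: (leP 0 (cos x)) => c0; [rewrite ger0_norm // => c1|rewrite ltr0_norm // => c1].
  have [z ->] : exists z : int, x = 0 + 2 * pi * z%:~R by apply: angle_eq_mod; rewrite ?cos0 ?sin0.
  by exists (2 * z); rewrite intrM; ring.
have [z ->] : exists z : int, x = pi + 2 * pi * z%:~R.
  by apply: angle_eq_mod; rewrite ?cospi ?sinpi // -c1 opprK.
by exists (2 * z + 1); rewrite intrD intrM; ring.
Qed.

Lemma sin_natpi n : sin (n%:R * pi : R) = 0.
Proof.
elim: n => [|n IH]; first by rewrite mul0r sin0.
by rewrite -natr1 mulrDl mul1r sinDpi IH oppr0.
Qed.

Lemma star_lines m (p : plane) : (0 < m)%N -> complex.Im (Complex p.1 p.2 ^+ m) = 0 <->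
  exists j x, (j < m)%N /\ p = polar (0, 0) x (j%:R * pi / m%:R).
Proof.
move=> m0; have m0' : m%:R != 0 :> R by rewrite pnatr_eq0 -lt0n.
split; last first.
  move=> [j [x [_ ->]]]; rewrite /polar /= !add0r de_Moivre /=.
  by rewrite [m%:R * _]mulrC divfK // sin_natpi mulr0.
have [r [a [r0 ha ->]]] := plane_polar p.
rewrite /polar /= !add0r de_Moivre /= => /eqP; rewrite mulf_eq0 expf_eq0 m0 /=.
case/orP => [/eqP ->|/eqP /sin_eq0[z Ez]].
  by exists 0%N, 0; split=> //; rewrite !mul0r !addr0.
have Ea : a = z%:~R * pi / m%:R by rewrite -Ez mulrC mulKf.
have pi0 := pi_gt0 R; have mp : 0 < m%:R :> R by rewrite ltr0n.
have z0 : 0 <= z.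
  rewrite -(ler0z R) -(pmulr_lge0 _ pi0) -Ez; case/andP: ha => ha _.
  by rewrite mulr_ge0 ?ler0n.
case: z z0 Ez Ea => // k _ Ez Ea.
have k2 : (k < m + m)%N.
  rewrite -(ltr_nat R) -(ltr_pM2r pi0); move: Ez; rewrite /= => <-.
  case/andP: ha => _ ha; rewrite natrD.
  by apply: le_lt_trans (_ : _ <= m%:R * a) _ => //; nra.
case: (ltnP k m) => km.
  by exists k, r; split => //; rewrite Ea /polar !add0r.
exists (k - m)%N, (- r); split; first by lia.
rewrite -[RHS]/(polar (0, 0) (- r) ((k - m)%:R * pi / m%:R)) polarNr.
have -> : (k - m)%:R * pi / m%:R + pi = a by rewrite Ea natrB // -pmulrn; field.
by rewrite /polar !add0r.
Qed.

End Embeddings.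

(** * A surface glued from planes *)

Section GluedSpace.
Variables (R : realType) (E : finType) (n : nat).
Variables (w : 'I_n.+1 -> E) (theta : 'I_n.+1 -> R).
Notation plane := (R * R)%type.

(** Each letter has a crossing plane; each place [k] of the word has a line, the
    middle of a neck between two ends of crossing planes. *)
Inductive glued_point := CrossPoint of E & plane | LinePoint of 'I_n.+1 & R.

(** The topology depends on [w] and [theta], which are mentioned so that it can
    be inferred from the type. *)
Definition glued : Type := let _ := (w, theta) in glued_point.
Definition Cross (e : E) (z : plane) : glued := CrossPoint e z.
Definition Line (k : 'I_n.+1) (y : R) : glued := LinePoint k y.

Lemma Cross_inj e e' z z' : Cross e z = Cross e' z' -> e = e' /\ z = z'.
Proof. by case. Qed.

Lemma Line_inj k k' y y' : Line k y = Line k' y' -> k = k' /\ y = y'.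
Proof. by case. Qed.

Lemma glued_ind (P : glued -> Prop) :
  (forall e z, P (Cross e z)) -> (forall k y, P (Line k y)) -> forall a, P a.
Proof. by move=> hC hL [e z|k y]; [exact: hC|exact: hL]. Qed.

(** The [k]-th branch of the curve runs in this frame along the first axis. *)
Definition leg (k : 'I_n.+1) (p : plane) : glued := Cross (w k) (turn p (theta k)).

(** The neck joins the outgoing end of the branch before the [k]-th to the
    incoming end of the [k]-th. If [x] is the coordinate along either branch, the
    first coordinate of the neck is [-1/x], and 0 in the middle: it increases in
    the direction of the curve. *)
Definition neck (k : 'I_n.+1) (p : plane) : glued :=
  if p.1 == 0 then Line k p.2
  else if p.1 < 0 then leg (ord_pred k) (flip p) else leg k (flip p).

Definition glued_open (U : set glued) :=
  (forall e z, U (Cross e z) -> nbhs z (fun z' => U (Cross e z'))) /\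
  (forall k y, U (Line k y) -> nbhs ((0, y) : plane) (fun p => U (neck k p))).

Lemma glued_openT : glued_open setT.
Proof. by split=> *; exact: filterT. Qed.

Lemma glued_openI U V : glued_open U -> glued_open V -> glued_open (U `&` V).
Proof.
move=> [U1 U2] [V1 V2]; split=> [e z [Uz Vz]|k y [Uy Vy]]; apply: filterI.
- exact: U1. - exact: V1. - exact: U2. - exact: V2.
Qed.

Lemma glued_open_bigU (I : Type) (U : I -> set glued) :
  (forall i, glued_open (U i)) -> glued_open (\bigcup_i U i).
Proof.
move=> oU; split=> [e z|k y] [i _ Ui]; have [h1 h2] := oU i.
  by apply: filterS (h1 _ _ Ui) => z' Uz'; exists i.
by apply: filterS (h2 _ _ Ui) => z' Uz'; exists i.
Qed.

HB.instance Definition _ := gen_eqMixin glued.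
HB.instance Definition _ := gen_choiceMixin glued.
HB.instance Definition _ := isOpenTopological.Build glued
  glued_openT glued_openI glued_open_bigU.

Lemma continuous_Cross e : continuous (Cross e).
Proof.
move=> z A /=; rewrite nbhsE => -[U [oU Uz] UA].
by apply: filterS (oU.1 _ _ Uz) => z' /UA.
Qed.

Lemma open_Cross e O : open O -> open (Cross e @` O).
Proof.
move=> oO; split=> [e' z [z' Oz' /Cross_inj[<- <-]]|k y [z' _ //]].
have nO : nbhs z' O by exact: open_nbhs_nbhs.
by apply: filterS nO => u Ou; exists u.
Qed.

Lemma continuous_leg k : continuous (leg k).
Proof.
move=> p; apply: (@continuous_comp _ _ _ (fun p : plane => turn p (theta k)) (Cross (w k))).
  exact: continuous_turn.
exact: continuous_Cross.
Qed.

Lemma near_lt0 (p : plane) : p.1 < 0 -> \forall q \near p, q.1 < 0.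
Proof. by move/(cvgr_lt _ (@continuous_fst_at R p)). Qed.

Lemma near_gt0 (p : plane) : 0 < p.1 -> \forall q \near p, 0 < q.1.
Proof. by move/(cvgr_gt _ (@continuous_fst_at R p)). Qed.

Lemma neck_lt0 k p : p.1 < 0 -> neck k p = leg (ord_pred k) (flip p).
Proof. by move=> p0; rewrite /neck p0 lt_eqF. Qed.

Lemma neck_gt0 k p : 0 < p.1 -> neck k p = leg k (flip p).
Proof. by move=> p0; rewrite /neck gt_eqF // ltNge ltW. Qed.

Lemma neck_eq0 k y : neck k (0, y) = Line k y.
Proof. by rewrite /neck eqxx. Qed.

Lemma continuous_neck k : continuous (neck k).
Proof.
move=> p; case: (ltgtP p.1 0) => p0.
- apply: (@near_cvg _ _ (fun p => leg (ord_pred k) (flip p))).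
    by apply: filterS (near_lt0 p0) => q q0; rewrite neck_lt0.
  apply: (@continuous_comp _ _ _ (@flip R) (leg _)); last exact: continuous_leg.
  by apply: continuous_flip; rewrite lt_eqF.
- apply: (@near_cvg _ _ (fun p => leg k (flip p))).
    by apply: filterS (near_gt0 p0) => q q0; rewrite neck_gt0.
  apply: (@continuous_comp _ _ _ (@flip R) (leg _)); last exact: continuous_leg.
  by apply: continuous_flip; rewrite gt_eqF.
case: p p0 => x y /= ->; move=> A /=; rewrite neck_eq0 nbhsE => -[U [oU Uz] UA].
by apply: filterS (oU.2 _ _ Uz) => q /UA.
Qed.

Definition frame (k : 'I_n.+1) (z : plane) : plane := turn z (- theta k).

Lemma frameK k : cancel (frame k) (@turn R ^~ (theta k)).
Proof. exact: turnNK. Qed.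

Lemma turn_frameK k p : frame k (turn p (theta k)) = p.
Proof. exact: turnK. Qed.

Lemma continuous_frame k : continuous (frame k).
Proof. exact: continuous_turn. Qed.

Lemma near_frame_lt0 k (z : plane) : (frame k z).1 < 0 -> \forall q \near z, (frame k q).1 < 0.
Proof. by move/near_lt0/(@continuous_frame k z). Qed.

Lemma near_frame_gt0 k (z : plane) : 0 < (frame k z).1 -> \forall q \near z, 0 < (frame k q).1.
Proof. by move/near_gt0/(@continuous_frame k z). Qed.

Lemma open_neck k O : open O -> open (neck k @` O).
Proof.
move=> oO; split=> [e z|l y] [p Op].
  have pull k' : (frame k' z).1 != 0 -> O (flip (frame k' z)) ->
      \forall z' \near z, O (flip (frame k' z')).
    move=> z0 Oz; have c : {for z, continuous (fun z => flip (frame k' z))}.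
      apply: (@continuous_comp _ _ _ (frame k') (@flip R)); first exact: continuous_frame.
      exact: continuous_flip.
    by apply: c; exact: open_nbhs_nbhs.
  case: (ltgtP p.1 0) => p0.
  - rewrite neck_lt0 // => /Cross_inj[<- zE].
    have fz : frame (ord_pred k) z = flip p by rewrite -zE turn_frameK.
    have x0 : 0 < (frame (ord_pred k) z).1 by rewrite fz flip_gt0.
    apply: filterS2 (near_frame_gt0 x0) (pull (ord_pred k) _ _) => [z' x' Oz'||].
    + exists (flip (frame (ord_pred k) z')) => //.
      by rewrite neck_lt0 ?flip_lt0 // flipK /leg frameK.
    + by rewrite gt_eqF.
    + by rewrite fz flipK.
  - rewrite neck_gt0 // => /Cross_inj[<- zE].
    have fz : frame k z = flip p by rewrite -zE turn_frameK.
    have x0 : (frame k z).1 < 0 by rewrite fz flip_lt0.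
    apply: filterS2 (near_frame_lt0 x0) (pull k _ _) => [z' x' Oz'||].
    + exists (flip (frame k z')) => //.
      by rewrite neck_gt0 ?flip_gt0 // flipK /leg frameK.
    + by rewrite lt_eqF.
    + by rewrite fz flipK.
  - by rewrite /neck p0 eqxx.
case: (ltgtP p.1 0) => p0; [by rewrite neck_lt0|by rewrite neck_gt0|].
case: p Op p0 => x y' Op /= p0; rewrite p0 neck_eq0 => /Line_inj[<- <-].
have nO : nbhs ((0, y') : plane) O by apply: open_nbhs_nbhs; rewrite -p0.
by apply: filterS nO => u Ou; exists u.
Qed.

(** * Separation of the necks *)

Variable c : R.
Hypothesis c1 : 1 <= c.
Hypothesis sep : forall k l, k != l -> w k = w l -> 3 <= c * `|sin (theta k - theta l)|.

(** A double cone around the [k]-th branch; the hypothesis on [c] makes it so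
    narrow that those of the branches through a crossing are disjoint. *)
Definition dcone (k : 'I_n.+1) (z : plane) := c * `|(frame k z).2| < `|(frame k z).1|.

(** In [dcone_disjoint], [X], [Y] and [B], [A] are the sizes of the coordinates
    of a point with respect to two lines, and [s] is the sine of their angle. *)
Lemma cone_bounds (C X Y s A B : R) : 1 <= C -> 0 <= X -> 0 <= Y ->
  X * s <= A + Y -> B <= X + Y -> 3 <= C * s -> C * Y < X -> C * A < B -> False.
Proof.
move=> C1 X0 Y0 e1 e2 hs h1 h2.
have f1 : X * 3 <= X * (C * s) by apply: ler_wpM2l.
have f2 : C * (X * s) <= C * (A + Y) by apply: ler_wpM2l => //; lra.
have f3 : Y <= C * Y by rewrite -[X in X <= _]mul1r ler_wpM2r.
have f4 : X * (C * s) = C * (X * s) by ring.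
rewrite mulrDr in f2; lra.
Qed.

Lemma dcone_disjoint k l z : k != l -> w k = w l -> dcone k z -> dcone l z -> False.
Proof.
move=> kl wkl; rewrite /dcone.
have -> : frame l z = turn (frame k z) (theta k - theta l).
  by rewrite /frame turnD; congr turn; ring.
have := sep kl wkl; case: (frame k z) => x y; rewrite /turn /=.
set C := cos _; set S := sin _ => hs h1 h2.
have hC : `|C| <= 1 by exact: cos_max.
have hS : `|S| <= 1 by exact: sin_max.
have e1 : `|x| * `|S| <= `|x * S + y * C| + `|y|.
  have -> : `|x| * `|S| = `|(x * S + y * C) - y * C| by rewrite -normrM; congr (`|_|); ring.
  apply: le_trans (ler_normB _ _) _; rewrite lerD2l normrM.
  by rewrite ler_piMr.
have e2 : `|x * C - y * S| <= `|x| + `|y|.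
  apply: le_trans (ler_normB _ _) _; rewrite !normrM.
  by apply: lerD; rewrite ler_piMr.
exact: (cone_bounds c1 (normr_ge0 x) (normr_ge0 y) e1 e2 hs h1 h2).
Qed.

Lemma near_dcone k z : dcone k z -> \forall z' \near z, dcone k z'.
Proof.
rewrite /dcone -subr_gt0 => hz.
have cc : {for z, continuous (fun z => `|(frame k z).1| - c * `|(frame k z).2|)}.
  have f1 : {for z, continuous (fun z => `|(frame k z).1|)}.
    apply: (@continuous_comp _ _ _ (fun z => (frame k z).1) (fun x : R => `|x|)); last exact: norm_continuous.
    exact: (continuous_comp (@continuous_frame k z) (@continuous_fst_at R (frame k z))).
  have f2 : {for z, continuous (fun z => `|(frame k z).2|)}.
    apply: (@continuous_comp _ _ _ (fun z => (frame k z).2) (fun x : R => `|x|)); last exact: norm_continuous.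
    exact: (continuous_comp (@continuous_frame k z) (@continuous_snd_at R (frame k z))).
  by apply: cvgB => //; apply: cvgM => //; exact: cvg_cst.
move/cvgr_gt: cc => /(_ _ hz).
by apply: filterS => z'; rewrite /= subr_gt0.
Qed.

(** The middle line of a neck and the part over the double cones of its two
    branches; [neck] is injective there. *)
Definition neck_dom : set plane := [set p | c * `|p.1 * p.2| < 1].

Lemma open_neck_dom : open neck_dom.
Proof.
apply: (@open_comp _ _ (fun p : plane => c * `|p.1 * p.2|) [set x | x < 1]); last exact: open_lt.
move=> p _; apply: cvgM; first exact: cvg_cst.
apply: cvg_norm; apply: cvgM; [exact: cvg_fst|exact: cvg_snd].
Qed.

Lemma neck_dom_axis x y : x = 0 \/ y = 0 -> neck_dom (x, y).
Proof. by rewrite /neck_dom /= => -[->|->]; rewrite ?mul0r ?mulr0 normr0 mulr0. Qed.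

Lemma neck_dom_dcone k p : p.1 != 0 -> neck_dom p -> dcone k (turn (flip p) (theta k)).
Proof.
move=> p0; rewrite /neck_dom /dcone turn_frameK /= normrN normfV => h.
have pn : 0 < `|p.1| by rewrite normr_gt0.
by rewrite -(ltr_pM2l pn) divff ?gt_eqF // mulrCA -normrM.
Qed.

Definition neck_inv (k : 'I_n.+1) (a : glued) : plane :=
  match a with
  | LinePoint _ y => (0, y)
  | CrossPoint e z =>
      if [&& e == w (ord_pred k), c * `|(frame (ord_pred k) z).2| < `|(frame (ord_pred k) z).1|
           & 0 < (frame (ord_pred k) z).1]
      then flip (frame (ord_pred k) z) else flip (frame k z)
  end.

Lemma neck_inv_exit k z : dcone (ord_pred k) z -> 0 < (frame (ord_pred k) z).1 ->
  neck_inv k (Cross (w (ord_pred k)) z) = flip (frame (ord_pred k) z).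
Proof. by rewrite /dcone /neck_inv /= eqxx => -> ->. Qed.

Lemma neck_inv_entry k z : dcone k z -> (frame k z).1 < 0 ->
  neck_inv k (Cross (w k) z) = flip (frame k z).
Proof.
move=> dk xk; rewrite /neck_inv /=; case: ifP => // /and3P[/eqP e dp xp].
have [kp|kp] := eqVneq k (ord_pred k); first by rewrite -kp.
by exfalso; exact: (dcone_disjoint kp e dk dp).
Qed.

Lemma neckK k p : neck_dom p -> neck_inv k (neck k p) = p.
Proof.
move=> Dp; case: (ltgtP p.1 0) => p0.
- rewrite neck_lt0 // /leg neck_inv_exit ?turn_frameK ?flipK ?flip_gt0 //.
  by apply: neck_dom_dcone => //; rewrite lt_eqF.
- rewrite neck_gt0 // /leg neck_inv_entry ?turn_frameK ?flipK ?flip_lt0 //.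
  by apply: neck_dom_dcone => //; rewrite gt_eqF.
- by case: p p0 {Dp} => x y /= ->; rewrite neck_eq0.
Qed.

(** Off the middle line the point determines its double cone, and the sign of the
    coordinate along the branch determines the end of that cone. *)
Lemma neck_uniq k l p q : neck_dom p -> neck_dom q -> neck k p = neck l q -> k = l.
Proof.
move=> Dp Dq; case: (ltgtP p.1 0) => p0; case: (ltgtP q.1 0) => q0.
- rewrite !neck_lt0 // => /Cross_inj[we ze].
  have dp : dcone (ord_pred k) (turn (flip p) (theta (ord_pred k))) by apply: neck_dom_dcone => //; rewrite lt_eqF.
  have dq : dcone (ord_pred l) (turn (flip q) (theta (ord_pred l))) by apply: neck_dom_dcone => //; rewrite lt_eqF.
  have [kl|kl] := eqVneq (ord_pred k) (ord_pred l); first exact: (can_inj (@ord_predK _)) kl.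
  by exfalso; rewrite -ze in dq; exact: (dcone_disjoint kl we dp dq).
- rewrite neck_lt0 // neck_gt0 // => /Cross_inj[we ze].
  have dp : dcone (ord_pred k) (turn (flip p) (theta (ord_pred k))) by apply: neck_dom_dcone => //; rewrite lt_eqF.
  have dq : dcone l (turn (flip q) (theta l)) by apply: neck_dom_dcone => //; rewrite gt_eqF.
  have [kl|kl] := eqVneq (ord_pred k) l.
    move: ze; rewrite kl => /(can_inj (turnK _)) /(congr1 fst) e.
    by have := flip_gt0 p; rewrite e p0 lt_gtF ?flip_lt0.
  by exfalso; rewrite -ze in dq; exact: (dcone_disjoint kl we dp dq).
- by case: q q0 {Dq} => x y /= ->; rewrite neck_lt0 // neck_eq0.
- rewrite neck_gt0 // neck_lt0 // => /Cross_inj[we ze].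
  have dp : dcone k (turn (flip p) (theta k)) by apply: neck_dom_dcone => //; rewrite gt_eqF.
  have dq : dcone (ord_pred l) (turn (flip q) (theta (ord_pred l))) by apply: neck_dom_dcone => //; rewrite lt_eqF.
  have [kl|kl] := eqVneq k (ord_pred l).
    move: ze; rewrite kl => /(can_inj (turnK _)) /(congr1 fst) e.
    by have := flip_lt0 p; rewrite e p0 lt_gtF ?flip_gt0.
  by exfalso; rewrite -ze in dq; exact: (dcone_disjoint kl we dp dq).
- rewrite !neck_gt0 // => /Cross_inj[we ze].
  have dp : dcone k (turn (flip p) (theta k)) by apply: neck_dom_dcone => //; rewrite gt_eqF.
  have dq : dcone l (turn (flip q) (theta l)) by apply: neck_dom_dcone => //; rewrite gt_eqF.
  have [//|kl] := eqVneq k l.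
  by exfalso; rewrite -ze in dq; exact: (dcone_disjoint kl we dp dq).
- by case: q q0 {Dq} => x y /= ->; rewrite neck_gt0 // neck_eq0.
- by case: p p0 {Dp} => x y /= ->; rewrite neck_eq0 neck_lt0.
- by case: p p0 {Dp} => x y /= ->; rewrite neck_eq0 neck_gt0.
- by case: p p0 {Dp} => x y /= ->; case: q q0 {Dq} => x' y' /= ->; rewrite !neck_eq0 => /Line_inj[].
Qed.

(** The middle lines are at infinite distance in the crossing planes, and the
    necks of different places are disjoint. *)
Lemma glued_hausdorff : hausdorff_space glued.
Proof.
have open_sep (a b : glued) (A B : set glued) : open A -> open B -> A a -> B b ->
    A `&` B = set0 -> cluster (nbhs a) b -> a = b.
  move=> oA oB Aa Bb AB0 cl.
  have [x] : A `&` B !=set0 by apply: cl; exact: open_nbhs_nbhs.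
  by rewrite AB0.
have plane_sep (z z' : plane) : z <> z' -> exists U U', [/\ open U, open U', U z, U' z' & U `&` U' = set0].
  move=> zz'; have : hausdorff_space plane by exact: norm_hausdorff.
  rewrite open_hausdorff => /(_ z z'); case; first exact/eqP.
  by move=> [U U'] /= [/set_mem Oz /set_mem U'z'] [oO oU' /eqP E0]; exists U, U'.
(* a bounded part of a crossing plane against the far part of a neck *)
have CL (e : E) (z : plane) k y : exists A B, [/\ open A, open B, A (Cross e z), B (Line k y) & A `&` B = set0].
  pose M := z.1 ^+ 2 + z.2 ^+ 2 + 1.
  have sc : continuous (fun p : plane => p.1 ^+ 2 + p.2 ^+ 2).
    by move=> p; apply: cvgD; apply: cvgM; first [exact: cvg_fst|exact: cvg_snd].
  have sc1 : continuous (fun p : plane => p.1 ^+ 2 * M).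
    by move=> p; apply: cvgM; last exact: cvg_cst; apply: cvgM; exact: cvg_fst.
  exists (Cross e @` ((fun p : plane => p.1 ^+ 2 + p.2 ^+ 2) @^-1` [set x | x < M])).
  exists (neck k @` ((fun p : plane => p.1 ^+ 2 * M) @^-1` [set x | x < 1])).
  split.
  - by apply: open_Cross; apply: open_comp => [p _|]; [exact: sc|exact: open_lt].
  - by apply: open_neck; apply: open_comp => [p _|]; [exact: sc1|exact: open_lt].
  - by exists z => //=; rewrite /M ltrDl.
  - by exists (0, y); rewrite ?neck_eq0 //= expr0n mul0r.
  apply/seteqP; split=> // a [[q /= qM <-] [p /= pM]].
  suff far k' : p.1 != 0 -> leg k' (flip p) <> Cross e q.
    case: (ltgtP p.1 0) => p0.
    - by rewrite neck_lt0 //; apply: far; rewrite lt_eqF.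
    - by rewrite neck_gt0 //; apply: far; rewrite gt_eqF.
    - by case: p p0 {pM far} => x y' /= ->; rewrite neck_eq0.
  move=> p0 /Cross_inj[_ qE]; move: qM; rewrite -qE !expr2 turn_dot /= -!expr2.
  rewrite sqrrN exprVn => qM.
  have pp : 0 < p.1 ^+ 2 by rewrite exprn_even_gt0.
  have : 1 <= p.1 ^+ 2 * M.
    rewrite -[1](@divff _ (p.1 ^+ 2)) ?gt_eqF // ler_pM2l //.
    by apply: le_trans (ltW qM); rewrite lerDl sqr_ge0.
  by rewrite leNgt pM.
move=> a b; elim/glued_ind: a => [e z|k y]; elim/glued_ind: b => [e' z'|k' y'].
- have [-> cl|ee'] := eqVneq e e'.
    have [->//|/eqP zz'] := eqVneq z z'.
    have [U [U' [oO oU' Oz U'z' E0]]] := plane_sep _ _ zz'.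
    apply: (@open_sep _ _ (Cross e' @` U) (Cross e' @` U')); [exact: open_Cross|exact: open_Cross|by exists z|by exists z'| |exact: cl].
    apply/seteqP; split=> // _ [[u Ou <-] [v Ov /Cross_inj[_ vu]]].
    have UU : (U `&` U') u by split=> //; rewrite -vu.
    by rewrite E0 in UU.
  apply: (@open_sep _ _ (range (Cross e)) (range (Cross e'))); try by apply: open_Cross; exact: openT.
  + by exists z. + by exists z'.
  apply/seteqP; split=> // _ [[u _ <-] [v _ /Cross_inj[/eqP]]].
  by rewrite eq_sym (negbTE ee').
- have [A [B [oA oB Aa Bb E0]]] := CL e z k' y'.
  exact: open_sep Aa Bb E0.
- have [A [B [oA oB Aa Bb E0]]] := CL e' z' k y.
  by apply: (open_sep _ _ _ _ oB oA Bb Aa); rewrite setIC.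
have [-> cl|kk'] := eqVneq k k'.
  have [->//|/eqP yy'] := eqVneq y y'.
  have yy : ((0, y) : plane) <> (0, y') by move=> [].
  have [U [U' [oO oU' Oz U'z' E0]]] := plane_sep _ _ yy.
  have oD := open_neck_dom.
  apply: (@open_sep _ _ (neck k' @` (U `&` neck_dom)) (neck k' @` (U' `&` neck_dom))) => //.
  + by apply: open_neck; exact: openI.
  + by apply: open_neck; exact: openI.
  + by exists (0, y); rewrite ?neck_eq0 //; split=> //; apply: neck_dom_axis; left.
  + by exists (0, y'); rewrite ?neck_eq0 //; split=> //; apply: neck_dom_axis; left.
  apply/seteqP; split=> // _ [[u [Ou Du] <-] [v [Ov Dv] /(congr1 (neck_inv k'))]].
  rewrite !neckK // => vu.
  have UU : (U `&` U') u by split=> //; rewrite -vu.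
    by rewrite E0 in UU.
have oD := open_neck_dom.
apply: (@open_sep _ _ (neck k @` neck_dom) (neck k' @` neck_dom)); try exact: open_neck.
+ by exists (0, y); rewrite ?neck_eq0 //; apply: neck_dom_axis; left.
+ by exists (0, y'); rewrite ?neck_eq0 //; apply: neck_dom_axis; left.
apply/seteqP; split=> // _ [[u Du <-] [v Dv /neck_uniq E1]].
by move: kk'; rewrite E1 ?eqxx.
Qed.

Lemma glued_second_countable : @second_countable glued.
Proof.
have [B cB [oB baseB]] := plane_countable_base R.
pose par (i : E + 'I_n.+1) : plane -> glued :=
  match i with inl e => Cross e | inr k => neck k end.
pose F (i : E + 'I_n.+1) : set (set glued) := (fun U => par i @` U) @` B.
exists (\bigcup_i F i).
  apply: bigcup_countable; first exact: countableP.
  by move=> i _; exact: sub_countable (card_image_le _ _) cB.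
split.
  move=> _ [i _ [U BO <-]]; case: i => [e|k]; first by apply: open_Cross; exact: oB.
  by apply: open_neck; exact: oB.
move=> a A nA; elim/glued_ind: a nA => [e z|k y] nA.
  have := @continuous_Cross e z A nA => /baseB [U [BO Oz OA]].
  exists (Cross e @` U); first by split; [exists (inl e) => //; exists U|exists z].
  by move=> _ [u Ou <-]; exact: OA.
have := @continuous_neck k (0, y) A; rewrite neck_eq0 => /(_ nA) /baseB [U [BO Oz OA]].
exists (neck k @` U); first by split; [exists (inr k) => //; exists U|exists (0, y); rewrite ?neck_eq0].
by move=> _ [u Ou <-]; exact: OA.
Qed.

(** * Charts *)

Definition param (i : E + 'I_n.+1) : plane -> glued :=
  match i with inl e => Cross e | inr k => neck k end.

Definition param_dom (i : E + 'I_n.+1) : set plane :=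
  match i with inl _ => setT | inr _ => neck_dom end.

Definition param_inv (i : E + 'I_n.+1) (a : glued) : plane :=
  match i with
  | inl _ => match a with CrossPoint _ z => z | LinePoint _ y => (0, y) end
  | inr k => neck_inv k a
  end.

Lemma continuous_param i : continuous (param i).
Proof. case: i => [e|k]; [exact: continuous_Cross|exact: continuous_neck]. Qed.

Lemma open_param i O : open O -> open (param i @` O).
Proof. case: i => [e|k]; [exact: open_Cross|exact: open_neck]. Qed.

Lemma open_param_dom i : open (param_dom i).
Proof. case: i => [e|k]; [exact: openT|exact: open_neck_dom]. Qed.

Lemma paramK i p : param_dom i p -> param_inv i (param i p) = p.
Proof. by case: i => [e|k] //=; exact: neckK. Qed.

Lemma param_cover a : exists i p, param_dom i p /\ param i p = a.
Proof.
elim/glued_ind: a => [e z|k y]; first by exists (inl e), z.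
by exists (inr k), (0, y); split; [apply: neck_dom_axis; left|rewrite /= neck_eq0].
Qed.

(** Between a crossing plane and a neck the transition is a rotation composed
    with [flip]; two necks never meet. *)
Lemma param_transition i j p q : param_dom i p -> param_dom j q -> param i p = param j q ->
  preserves_orientation_at (param_inv j \o param i) p.
Proof.
case: i j => [e|k] [e'|l] /= Dp Dq pq.
- by apply: preserves_id; apply: filterS (@filterT _ (nbhs p) _) => u _.
- have zE (m : 'I_n.+1) (u : plane) : turn u (- theta m) = frame m u by [].
  case: (ltgtP q.1 0) => q0; last by case: q pq q0 {Dq} => x y /= + x0; rewrite x0 neck_eq0.
    move: pq; rewrite neck_lt0 // => /Cross_inj[-> pE].
    have fp : frame (ord_pred l) p = flip q by rewrite pE turn_frameK.
    have d : dcone (ord_pred l) p by rewrite pE; apply: neck_dom_dcone => //; rewrite lt_eqF.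
    have x0 : 0 < (frame (ord_pred l) p).1 by rewrite fp flip_gt0.
    apply: (@preserves_turn_flip _ _ _ 0 (- theta (ord_pred l))); first by rewrite zE gt_eqF.
    apply: filterS2 (near_dcone d) (near_frame_gt0 x0) => u du xu.
    by rewrite turn0; exact: neck_inv_exit.
  move: pq; rewrite neck_gt0 // => /Cross_inj[-> pE].
  have fp : frame l p = flip q by rewrite pE turn_frameK.
  have d : dcone l p by rewrite pE; apply: neck_dom_dcone => //; rewrite gt_eqF.
  have x0 : (frame l p).1 < 0 by rewrite fp flip_lt0.
  apply: (@preserves_turn_flip _ _ _ 0 (- theta l)); first by rewrite zE lt_eqF.
  apply: filterS2 (near_dcone d) (near_frame_lt0 x0) => u du xu.
  by rewrite turn0; exact: neck_inv_entry.
- case: (ltgtP p.1 0) => p0; last by case: p pq p0 {Dp} => x y /= + x0; rewrite x0 neck_eq0.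
    apply: (@preserves_turn_flip _ _ _ (theta (ord_pred k)) 0); first by rewrite turn0 lt_eqF.
    by apply: filterS (near_lt0 p0) => u u0; rewrite /= neck_lt0 // turn0.
  apply: (@preserves_turn_flip _ _ _ (theta k) 0); first by rewrite turn0 gt_eqF.
  by apply: filterS (near_gt0 p0) => u u0; rewrite /= neck_gt0 // turn0.
- rewrite (neck_uniq Dp Dq pq); apply: preserves_id.
  have nD : nbhs p neck_dom by apply: open_nbhs_nbhs; split=> //; exact: open_neck_dom.
  by apply: filterS nD => u Du /=; exact: neckK.
Qed.

(** Charts take values in the closed half-plane: the part of a parameter plane
    above height [b] is translated into the open half-plane, which keeps the
    transitions and leaves the surface without boundary. *)
Definition patch_img i (b : R) : set plane := [set p | param_dom i (p + (0, b)) /\ 0 < p.2].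
Definition patch_map i (b : R) (a : glued) : plane := param_inv i a - (0, b).
Definition patch_inv i (b : R) (p : plane) : glued := param i (p + (0, b)).
Definition patch_dom i (b : R) : set glued := patch_inv i b @` patch_img i b.

Lemma continuous_shift (v : plane) : continuous (fun p : plane => p + v).
Proof. by move=> p; apply: cvgD; [exact: cvg_id|exact: cvg_cst]. Qed.

Lemma open_shift (v : plane) (O : set plane) : open O -> open ((fun p => p + v) @` O).
Proof.
move=> oO; rewrite (_ : _ @` _ = (fun p => p - v) @^-1` O).
  by apply: open_comp => // p _; exact: continuous_shift.
apply/seteqP; split => p /=; first by move=> [u Ou <-]; rewrite addrK.
by move=> Op; exists (p - v); rewrite ?subrK.
Qed.

Lemma open_patch_img i b : open (patch_img i b).
Proof.
apply: openI.
  apply: (@open_comp _ _ (fun p : plane => p + (0, b)) (param_dom i)); last exact: open_param_dom.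
  by move=> p _; exact: continuous_shift.
apply: (@open_comp _ _ (fun p : plane => p.2) [set x | 0 < x]); last exact: open_gt.
by move=> p _; exact: cvg_snd.
Qed.

Lemma patchK i b p : patch_img i b p -> patch_map i b (patch_inv i b p) = p.
Proof. by move=> [Dp _]; rewrite /patch_map /patch_inv paramK // addrK. Qed.

Lemma continuous_patch_inv i b : continuous (patch_inv i b).
Proof.
move=> p; apply: (@continuous_comp _ _ _ (fun p : plane => p + (0, b)) (param i)).
  exact: continuous_shift.
exact: continuous_param.
Qed.

Lemma open_patch_inv i b O : open O -> open (patch_inv i b @` O).
Proof.
move=> oO; rewrite (_ : _ @` _ = param i @` ((fun p => p + (0, b)) @` O)).
  by apply: open_param; exact: open_shift.
by rewrite image_comp.
Qed.

Lemma open_patch_dom i b : open (patch_dom i b).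
Proof. by apply: open_patch_inv; exact: open_patch_img. Qed.

Lemma patch_img_half i b :
  exists2 O : set plane, open O & patch_img i b = O `&` @halfplane R.
Proof.
exists (patch_img i b); first exact: open_patch_img.
by apply/seteqP; split => p; [move=> h; split=> //; case: h => _ /ltW|case].
Qed.

Definition patch i b : chart R glued :=
  Chart (open_patch_dom i b) (patch_img_half i b)
    (homeo_on_open_image (@continuous_patch_inv i b) (@open_patch_inv i b)
       (@open_patch_img i b) (@patchK i b)).

Definition glued_atlas : set (chart R glued) := [set c' | exists i b, c' = patch i b].

Lemma patch_at i p : param_dom i p -> chart_dom (patch i (p.2 - 1)) (param i p).
Proof.
move=> Dp; exists (p - (0, p.2 - 1)); last by rewrite /patch_inv subrK.
split; first by rewrite subrK.
by rewrite /= opprB addrCA subrr addr0.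
Qed.

Lemma glued_atlas_cover a : exists2 c', glued_atlas c' & chart_dom c' a.
Proof.
have [i [p [Dp <-]]] := param_cover a.
by exists (patch i (p.2 - 1)); [exists i, (p.2 - 1)|exact: patch_at].
Qed.

Lemma param_positive i p c' : param_dom i p -> glued_atlas c' -> chart_dom c' (param i p) ->
  preserves_orientation_at (chart_map c' \o param i) p.
Proof.
move=> Dp [j [b ->]] [q [Dq _] qp].
have := param_transition Dp Dq (esym qp); rewrite -[p in preserves_orientation_at _ p]addr0.
move=> /(preserves_translate (0, b)).
by congr preserves_orientation_at; apply/funext => u; rewrite /= addr0.
Qed.

Lemma glued_atlas_oriented c' c'' a : glued_atlas c' -> glued_atlas c'' ->
  chart_dom c' a -> chart_dom c'' a -> 0 < (chart_map c' a).2 ->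
  preserves_orientation_at (chart_map c'' \o chart_inv c') (chart_map c' a).
Proof.
move=> [i [b ->]] [j [b' ->]] [p [Dp p0] <-] [q [Dq q0] qp] _ /=.
rewrite patchK //.
have := param_transition Dp Dq (esym qp).
move=> /(preserves_translate (0, b')).
by apply.
Qed.

Definition glued_surface : surface R :=
  @Surface R glued glued_atlas glued_hausdorff glued_second_countable
    glued_atlas_cover glued_atlas_oriented.

Lemma glued_boundary : @boundary R glued_surface = set0.
Proof.
apply/seteqP; split=> // a [_ [[i [b ->]] [p Dp <-]]] /=.
have E1 := congr1 snd (patchK Dp).
by move=> p0; case: Dp => _; rewrite -E1 /= p0 ltxx.
Qed.

End GluedSpace.

(** * Star neighbourhoods *)

Section StarNeighbourhoods.
Variables (R : realType) (Sigma : surface R) (f : R * R -> Sigma).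
Notation plane := (R * R)%type.

Definition blow (q : plane) (r : R) (p : plane) : plane := (q.1 + r * p.1, q.2 + r * p.2).
Definition shrink (q : plane) (r : R) (p : plane) : plane := ((p.1 - q.1) / r, (p.2 - q.2) / r).

Lemma blowK q r : r != 0 -> cancel (blow q r) (shrink q r).
Proof.
move=> r0 [x y]; rewrite /shrink /blow /=.
by congr pair; rewrite addrAC subrr add0r mulrC mulKf.
Qed.

Lemma shrinkK q r : r != 0 -> cancel (shrink q r) (blow q r).
Proof.
move=> r0 [x y]; rewrite /shrink /blow /=.
by congr pair; rewrite mulrC divfK // addrC subrK.
Qed.

Lemma continuous_blow q r : continuous (blow q r).
Proof.
move=> p; apply: continuous_plane; apply: cvgD; try exact: cvg_cst;
  apply: cvgM; first [exact: cvg_cst|exact: cvg_fst|exact: cvg_snd].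
Qed.

Lemma continuous_shrink q r : continuous (shrink q r).
Proof.
move=> p; apply: continuous_plane; apply: cvgM; try exact: cvg_cst;
  apply: cvgB; first [exact: cvg_cst|exact: cvg_fst|exact: cvg_snd].
Qed.

Lemma open_blow q r O : r != 0 -> open O -> open (blow q r @` O).
Proof.
move=> r0 oO; rewrite (_ : _ @` _ = shrink q r @^-1` O).
  by apply: open_comp => // p _; exact: continuous_shrink.
apply/seteqP; split => p /=; first by move=> [u Ou <-]; rewrite blowK.
by move=> Op; exists (shrink q r p); rewrite ?shrinkK.
Qed.

(** The disc is compact, so that its image is closed, and [h] is continuous on the
    open image of [D]. *)
Lemma star_nbhd_of_disc (a : Sigma) (m : nat) (g : plane -> Sigma) (h : Sigma -> plane)
    (D : set plane) (q : plane) (r : R) :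
  continuous g -> (forall O, open O -> open (g @` O)) -> open D ->
  (forall p, D p -> h (g p) = p) -> 0 < r -> g q = a ->
  (forall p, disc p -> D (blow q r p)) ->
  (forall p, disc p -> ((f @` @S1 R) (g (blow q r p)) <-> complex.Im (Complex p.1 p.2 ^+ m) = 0)) ->
  star_nbhd f a m ((g \o blow q r) @` @disc R) (shrink q r \o h) (g \o blow q r).
Proof.
move=> cg og oD hg r0 gq discD fstar; have rn : r != 0 by rewrite gt_eqF.
have cG : continuous (g \o blow q r).
  by move=> p; apply: continuous_comp; [exact: continuous_blow|exact: cg].
have HG p : disc p -> (shrink q r \o h) ((g \o blow q r) p) = p.
  by move=> Dp; rewrite /= hg ?blowK //; exact: discD.
have blow0 : blow q r (0, 0) = q by rewrite /blow !mulr0 !addr0; case: (q).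
have disc0 : disc ((0, 0) : plane) by rewrite /disc /= expr0n addr0.
split.
- apply: compact_closed; first exact: surface_hausdorff.
  by apply: continuous_compact; [exact: continuous_subspaceT|exact: compact_disc].
- pose U : set plane := (fun p : plane => p.1 ^+ 2 + p.2 ^+ 2) @^-1` [set x | x < 1].
  have oU : open U.
    apply: open_comp; last exact: open_lt.
    by move=> p _; apply: cvgD; apply: cvgM; first [exact: cvg_fst|exact: cvg_snd].
  apply: (@filterS _ _ _ (g @` (blow q r @` U))).
    by move=> _ [_ [p Up <-] <-]; exists p => //; exact: ltW.
  apply: open_nbhs_nbhs; split; first by apply: og; exact: open_blow.
  by exists q => //; exists (0, 0) => //; rewrite /U /= expr0n addr0.
- apply: homeo_on_image => //; first exact: continuous_subspaceT.
  apply: continuous_in_subspaceT => _ /set_mem [p Dp <-].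
  apply: (@continuous_comp _ _ _ h (shrink q r)); last exact: continuous_shrink.
  exact: (continuous_left_inverse og oD hg (discD p Dp)).
- by have := HG _ disc0; rewrite /= blow0 gq.
apply/seteqP; split => [_ [y [fy [p Dp pE]] <-]|p [Dp Ip]].
  by move: fy; rewrite -pE HG // => fy; split=> //; apply/fstar.
exists ((g \o blow q r) p); last exact: HG.
by split; [apply/fstar|exists p].
Qed.

End StarNeighbourhoods.

(** * Parametrization of the circle *)

Section CircleParam.
Variable R : realType.
Notation plane := (R * R)%type.

(** The angle is the arc tangent of the slope seen from [x], which is continuous
    and vanishes at [x]. *)
Lemma S1_near (x : plane) (e : R) : S1 x -> 0 < e ->
  \forall p \near x, S1 p -> exists2 s, `|s| < e & p = turn x s.
Proof.
move=> Sx e0.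
pose d (p : plane) := p.1 * x.1 + p.2 * x.2.
pose c (p : plane) := x.1 * p.2 - x.2 * p.1.
have cd : continuous d.
  by move=> p; apply: cvgD; apply: cvgM; first [exact: cvg_fst|exact: cvg_snd|exact: cvg_cst].
have cc : continuous c.
  by move=> p; apply: cvgB; apply: cvgM; first [exact: cvg_fst|exact: cvg_snd|exact: cvg_cst].
have dx : d x = 1 by rewrite /d -!expr2; exact: Sx.
have cx : c x = 0 by rewrite /c mulrC subrr.
have ca : {for x, continuous (fun p => atan (c p / d p))}.
  apply: (@continuous_comp _ _ _ (fun p => c p / d p) (@atan R)); last exact: continuous_atan.
  by apply: cvgM; [exact: cc|apply: cvgV; [rewrite dx oner_neq0|exact: cd]].
have n1 : \forall p \near x, 0 < d p.
  have := cd x; move/cvgr_gt; apply; rewrite dx; exact: ltr01.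
have n2 : \forall p \near x, `|atan (c p / d p)| < e.
  move: ca; rewrite /prop_for /continuous_at cx mul0r atan0 => /cvgr0_norm_lt; exact.
apply: filterS2 n1 n2 => p dp ep Sp.
exists (atan (c p / d p)) => //; set A := atan _.
have cA : 0 < cos A by apply: cos_gt0_pihalf; rewrite atan_gtNpi2 atan_ltpi2.
have sA : sin A * d p = c p * cos A.
  by rewrite -[c p](@divfK _ (d p)) ?gt_eqF // -[c p / d p]atanK /tan -/A mulrAC divfK ?gt_eqF // mulrC.
have cd1 : d p ^+ 2 + c p ^+ 2 = 1.
  have -> : d p ^+ 2 + c p ^+ 2 = (x.1 ^+ 2 + x.2 ^+ 2) * (p.1 ^+ 2 + p.2 ^+ 2) by rewrite /d /c; ring.
  by rewrite (Sx : _ + _ = 1) (Sp : _ + _ = 1) mulr1.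
have cAd : cos A = d p.
  have : cos A ^+ 2 = d p ^+ 2.
    have h := cos2Dsin2 A; transitivity (cos A ^+ 2 * (d p ^+ 2 + c p ^+ 2)); first by rewrite cd1 mulr1.
    rewrite mulrDr -[cos A ^+ 2 * c p ^+ 2]exprMn mulrC [cos A * _]mulrC -sA exprMn mulrC -mulrDl h mul1r //.
  by move/eqP; rewrite eqrXn2 ?ltW // => /eqP.
have sAc : sin A = c p by apply: (mulIf (x := d p)); rewrite ?gt_eqF // sA cAd.
rewrite /turn cAd sAc [LHS]surjective_pairing /d /c.
have h : x.1 ^+ 2 + x.2 ^+ 2 = 1 by exact: Sx.
by congr pair; rewrite -[LHS]mul1r -h; ring.
Qed.

Lemma two_pi_neq0 : 2 * pi != 0 :> R.
Proof. by rewrite gt_eqF ?two_pi_gt0. Qed.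

Lemma scaleK (M a : R) : M != 0 -> 2 * pi * (M * a / (2 * pi)) / M = a.
Proof. by have := two_pi_neq0; move: (2 * pi) => P P0 M0; field; rewrite ?M0 ?P0. Qed.

Lemma scaleD (M s d : R) : M != 0 ->
  2 * pi * (s + M * d / (2 * pi)) / M = 2 * pi * s / M + d.
Proof. by have := two_pi_neq0; move: (2 * pi) => P P0 M0; field; rewrite ?M0 ?P0. Qed.

Lemma scale_period (M s y : R) : M != 0 ->
  2 * pi * (s + M * y) / M = 2 * pi * s / M + 2 * pi * y.
Proof. by move=> M0; field. Qed.

Lemma scale_eq (M s s' y : R) : M != 0 ->
  2 * pi * s / M = 2 * pi * s' / M + 2 * pi * y -> s = s' + M * y.
Proof.
have := two_pi_neq0; move: (2 * pi) => P P0 M0 H.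
have -> : s = P * s / M * (M / P) by field; rewrite ?M0 ?P0.
by rewrite H; field; rewrite ?M0 ?P0.
Qed.

Definition arg (p : plane) : R := xget 0 [set a | p = (cos a, sin a)].

Lemma argK p : S1 p -> p = (cos (arg p), sin (arg p)).
Proof.
move=> /S1_angle[a _ pa].
exact: (@xgetPex _ 0 [set a | p = (cos a, sin a)] (ex_intro _ a pa)).
Qed.

End CircleParam.

(** * A curve through all branches *)

Section Curve.
Variables (R : realType) (E : finType) (n : nat).
Variables (w : 'I_n.+1 -> E) (theta : 'I_n.+1 -> R) (c : R).
Hypothesis c1 : 1 <= c.
Hypothesis sep : forall k l, k != l -> w k = w l -> 3 <= c * `|sin (theta k - theta l)|.
Notation plane := (R * R)%type.
Let Sigma := glued_surface c1 sep.
Local Notation N := n.+1.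
Local Notation Cross := (@Cross R E n w theta).
Local Notation Line := (@Line R E n w theta).
Local Notation leg := (@leg R E n w theta).
Local Notation neck := (@neck R E n w theta).
Local Notation half := (2^-1 : R).

Lemma half_half : half + half = 1.
Proof. by field. Qed.

Definition idx (z : int) : 'I_N := inord `|(z %% N)%Z|.

Lemma val_idx z : (idx z : nat)%:Z = (z %% N)%Z.
Proof.
have h0 : (0 <= z %% N)%Z by rewrite modz_ge0.
have h1 : (z %% N < N)%Z by rewrite ltz_pmod.
by rewrite /idx inordK -?ltz_nat gez0_abs.
Qed.

Lemma idx_nat (k : 'I_N) : idx k = k.
Proof. by apply/val_inj/eqP; rewrite /= -eqz_nat val_idx modz_small //= ltz_nat. Qed.

Lemma idx_period z y : idx (z + N%:Z * y) = idx z.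
Proof. by apply/val_inj/eqP; rewrite /= -eqz_nat !val_idx addrC mulrC modzMDl. Qed.

Lemma idx_eq z z' : idx z = idx z' -> exists y, z = z' + N%:Z * y.
Proof.
move=> /(congr1 (fun i : 'I_N => (i : nat)%:Z)); rewrite !val_idx => E1.
exists ((z %/ N)%Z - (z' %/ N)%Z).
by rewrite {1}(divz_eq z N) {1}(divz_eq z' N) E1; ring.
Qed.

Lemma ord_pred_idx z : ord_pred (idx z) = idx (z - 1).
Proof.
apply/val_inj/eqP; rewrite /= -eqz_nat val_idx -modz_nat.
have -> : ((idx z + N).-1 : nat)%:Z = (idx z : nat)%:Z + N%:Z - 1 by rewrite addnS /=; lia.
by rewrite val_idx addrAC modzDr modzDml.
Qed.

(** At times in (k, k + 1) the curve runs along the branch [k], through the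
    crossing at [k + 1/2]; at integer times it is on the middle line of a neck.
    Places are counted modulo the length of the word. *)
Definition gamma (s : R) : glued w theta :=
  let z := Num.floor s in
  if s == z%:~R then Line (idx z) 0
  else leg (idx z) (tan (pi * (s - z%:~R - half)), 0).

Lemma gamma_int (z : int) : gamma z%:~R = Line (idx z) 0.
Proof. by rewrite /gamma intrKfloor eqxx. Qed.

Lemma gamma_leg (z : int) (v : R) : 0 < v < 1 ->
  gamma (z%:~R + v) = leg (idx z) (tan (pi * (v - half)), 0).
Proof.
move=> /andP[v0 v1]; rewrite /gamma.
have -> : Num.floor (z%:~R + v) = z.
  by apply: floor_def; rewrite intrD lerDl ltrD2l (ltW v0) v1.
rewrite -subr_eq0 addrAC subrr add0r gt_eqF //.
Qed.

Lemma half_lt (d : R) : `|d| < half -> `|pi * d| < pi / 2.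
Proof.
by move=> h; rewrite normrM gtr0_norm ?pi_gt0 // ltr_pM2l ?pi_gt0.
Qed.

Lemma cos_gt0_half (d : R) : `|d| < half -> 0 < cos (pi * d).
Proof. by move=> /half_lt; rewrite ltr_norml => h; exact: cos_gt0_pihalf. Qed.

Lemma tan_half_inj (d d' : R) : `|d| < half -> `|d'| < half ->
  tan (pi * d) = tan (pi * d') -> d = d'.
Proof.
move=> /half_lt h /half_lt h' /tan_inj E1.
apply: (mulfI (x := pi)); first by rewrite gt_eqF ?pi_gt0.
by apply: E1; rewrite in_itv /= -ltr_norml.
Qed.

Lemma tan_half_sg (d : R) : `|d| < half -> ((0 < tan (pi * d)) = (0 < d)) * ((tan (pi * d) < 0) = (d < 0)).
Proof.
move=> h; have h0 : `|0 : R| < half by rewrite normr0 invr_gt0.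
have h' := half_lt h; have h0' := half_lt h0.
have p0 := pi_gt0 R.
rewrite -{1 3}(tan0 R) -(mulr0 pi) !ltr_tan ?in_itv /= -?ltr_norml // !ltr_pM2l //.
by rewrite mulr0.
Qed.

Lemma tan_half_surj (x : R) : exists2 d, `|d| < half & tan (pi * d) = x.
Proof.
exists (atan x / pi); last by rewrite mulrC divfK ?gt_eqF ?pi_gt0 // atanK.
rewrite normrM normfV (gtr0_norm (pi_gt0 R)) ltr_pdivrMr ?pi_gt0 // mulrC.
by rewrite ltr_norml atan_gtNpi2 atan_ltpi2.
Qed.

Lemma gamma_neck (z : int) (d : R) : `|d| < half ->
  gamma (z%:~R + d) = neck (idx z) (tan (pi * d), 0).
Proof.
move=> hd; have [t1 t2] := tan_half_sg hd.
move: (hd); rewrite ltr_norml => /andP[hd1 hd2].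
have half1 := half_half.
case: (ltgtP d 0) => d0.
- have -> : z%:~R + d = (z - 1)%:~R + (1 + d) by rewrite intrB; ring.
  rewrite gamma_leg; last by apply/andP; split; lra.
  rewrite neck_lt0 ?t2 // ord_pred_idx; congr (leg _ (_, _)).
  have -> : pi * (1 + d - half) = pi * d + pi / 2 by field.
  by rewrite /tan /= sinDpihalf cosDpihalf invf_div invrN mulrN.
- rewrite gamma_leg; last by apply/andP; split; lra.
  rewrite neck_gt0 ?t1 //; congr (leg _ (_, _)).
  have -> : pi * (d - half) = pi * d - pi / 2 by ring.
  by rewrite /tan sinBpihalf cosBpihalf /= invf_div mulNr.
by rewrite d0 addr0 gamma_int mulr0 tan0 neck_eq0.
Qed.

Lemma param_cases (s : R) :
  (exists z : int, exists2 d, `|d| < half & s = z%:~R + d) \/ (exists z : int, s = z%:~R + half).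
Proof.
have /andP[h1 h2] := Num.Theory.floor_itv s.
move: h1 h2; set z := Num.floor s; rewrite intrD => h1 h2.
have half1 := half_half.
case: (ltgtP (s - z%:~R) half) => h.
- left; exists z, (s - z%:~R); last by ring.
  by rewrite ltr_norml; apply/andP; split; lra.
- left; exists (z + 1), (s - z%:~R - 1); last by rewrite intrD; ring.
  by rewrite ltr_norml; apply/andP; split; lra.
- by right; exists z; rewrite -h addrC subrK.
Qed.

Lemma gamma_half (z : int) : gamma (z%:~R + half) = Cross (w (idx z)) (0, 0).
Proof.
have half1 := half_half.
rewrite gamma_leg; last by apply/andP; split; lra.
by rewrite subrr mulr0 tan0 /leg turn_origin.
Qed.

Lemma gamma_period s (y : int) : gamma (s + (N%:Z * y)%:~R) = gamma s.
Proof.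
case: (param_cases s) => [[z [d hd ->]]|[z ->]].
  by rewrite addrAC -intrD !gamma_neck // idx_period.
by rewrite addrAC -intrD !gamma_half idx_period.
Qed.

Lemma continuous_tan_half (m s : R) : `|s - m| < half ->
  {for s, continuous (fun s => (tan (pi * (s - m)), 0) : plane)}.
Proof.
move=> hs; apply: continuous_plane; last exact: cst_continuous.
apply: (@continuous_comp _ _ _ (fun s => pi * (s - m)) (@tan R)).
  by apply: cvgM; [exact: cvg_cst|apply: cvgB; [exact: cvg_id|exact: cvg_cst]].
by apply: continuous_tan; rewrite gt_eqF // cos_gt0_half.
Qed.

Lemma near_dist (m s : R) : `|s - m| < half -> \forall t \near s, `|t - m| < half.
Proof.
move=> h; have cc : {for s, continuous (fun t => `|t - m|)}.
  by apply: cvg_norm; apply: cvgB; [exact: cvg_id|exact: cvg_cst].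
by move/cvgr_lt: cc => /(_ _ h).
Qed.

Lemma continuous_gamma : continuous gamma.
Proof.
have half1 := half_half.
move=> s; case: (param_cases s) => [[z [d hd sE]]|[z sE]].
  have hs : `|s - z%:~R| < half by rewrite sE addrAC subrr add0r.
  apply: (@near_cvg R _ (fun s : R => neck (idx z) (tan (pi * (s - z%:~R)), 0))).
    by apply: filterS (near_dist hs) => t ht; rewrite -gamma_neck // addrC subrK.
  apply: (@continuous_comp R _ _ _ (neck (idx z)) _ (continuous_tan_half hs)).
  exact: continuous_neck.
have hs : `|s - (z%:~R + half)| < half by rewrite sE subrr normr0 invr_gt0.
apply: (@near_cvg R _ (fun s : R => leg (idx z) (tan (pi * (s - (z%:~R + half))), 0))).
  apply: filterS (near_dist hs) => t; rewrite ltr_norml => /andP[h1 h2].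
  have tE : t = z%:~R + (t - z%:~R) by ring.
  rewrite [X in _ = gamma X]tE gamma_leg; last by apply/andP; split; lra.
  by congr (leg _ (tan (_ * _), _)); rewrite opprD addrA.
apply: (@continuous_comp R _ _ _ (leg (idx z)) _ (continuous_tan_half hs)).
exact: continuous_leg.
Qed.

Lemma dcone_axis k (x : R) : x != 0 -> dcone theta c k (turn (x, 0) (theta k)).
Proof. by move=> x0; rewrite /dcone turn_frameK /= normr0 mulr0 normr_gt0. Qed.

Lemma leg_axis_inj k l (x y : R) : x != 0 -> leg k (x, 0) = leg l (y, 0) -> k = l /\ x = y.
Proof.
move=> x0 /Cross_inj[wkl tE].
have y0 : y != 0.
  apply: contraNneq x0 => y0; move: tE; rewrite y0 turn_origin => /(congr1 (fun p => turn p (- theta k))).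
  by rewrite turn_origin turnK => -[->].
have [kl|kl] := eqVneq k l; last first.
  exfalso; have dl := dcone_axis l y0; rewrite -tE in dl.
  exact: (dcone_disjoint c1 sep kl wkl (dcone_axis k x0) dl).
by split=> //; move: tE; rewrite kl => /(can_inj (turnK _))[].
Qed.

(** Off the crossings a point of the curve lies in the double cone of a single
    branch. *)
Lemma gamma_inj s s' : gamma s = gamma s' ->
  (exists y : int, s = s' + (N%:Z * y)%:~R) \/
  (exists z z' : int, [/\ s = z%:~R + half, s' = z'%:~R + half & w (idx z) = w (idx z')]).
Proof.
have half1 := half_half.
have decomp (t : R) : exists z : int, exists2 v, 0 <= v < 1 & t = z%:~R + v.
  exists (Num.floor t), (t - (Num.floor t)%:~R); last by rewrite addrC subrK.
  have /andP[h1 h2] := Num.Theory.floor_itv t.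
  by rewrite subr_ge0 h1 ltrBlDl -[X in _ + X](mulr1z 1) -intrD.
have [z [v /andP[v0 v1] ->]] := decomp s; have [z' [v' /andP[v'0 v'1] ->]] := decomp s'.
move: v0 v'0; rewrite !le_eqVlt => /orP[/eqP <-|v0] /orP[/eqP <-|v'0].
- rewrite !addr0 !gamma_int => /Line_inj[/idx_eq[y ->] _].
  by left; exists y; rewrite intrD.
- by rewrite addr0 gamma_int gamma_leg ?v'0.
- by rewrite addr0 gamma_int gamma_leg ?v0.
rewrite !gamma_leg ?v0 ?v'0 //.
have hv : `|v - half| < half by rewrite ltr_norml; apply/andP; split; lra.
have hv' : `|v' - half| < half by rewrite ltr_norml; apply/andP; split; lra.
have tan_eq0 d : `|d| < half -> tan (pi * d) = 0 -> d = 0.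
  move=> hd t0; apply: tan_half_inj => //; first by rewrite normr0 invr_gt0.
  by rewrite t0 mulr0 tan0.
have [x0|x0] := eqVneq (tan (pi * (v - half))) 0.
  have [y0 lE|y0 /esym/(leg_axis_inj y0)[_ yE]] := eqVneq (tan (pi * (v' - half))) 0.
    right; exists z, z'; split.
    + by rewrite -[v](subrK half) (tan_eq0 _ hv x0) add0r.
    + by rewrite -[v'](subrK half) (tan_eq0 _ hv' y0) add0r.
    + by have [] := Cross_inj lE.
  by rewrite yE x0 eqxx in y0.
move=> /(leg_axis_inj x0)[/idx_eq[y ->] /(tan_half_inj hv hv') vE].
left; exists y; rewrite intrD (_ : v = v'); first by ring.
by rewrite -[v](subrK half) vE subrK.
Qed.

Lemma gamma_image a : (exists s, gamma s = a) <->
  (exists k, a = Line k 0) \/ (exists k x, a = leg k (x, 0)).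
Proof.
have half1 := half_half.
split=> [[s <-]|[[k ->]|[k [x ->]]]].
- rewrite /gamma; case: ifP => _; first by left; exists (idx (Num.floor s)).
  by right; exists (idx (Num.floor s)), (tan (pi * (s - (Num.floor s)%:~R - half))).
- by exists (k%:Z)%:~R; rewrite gamma_int idx_nat.
have [d hd <-] := tan_half_surj x.
exists ((k%:Z)%:~R + (d + half)); rewrite gamma_leg ?idx_nat ?addrK //.
by move: hd; rewrite ltr_norml => /andP[h1 h2]; apply/andP; split; lra.
Qed.

(** Each branch lies in its own double cone, so that of all branches only the two
    joined by a neck meet it. *)
Lemma neck_on_curve k q : neck_dom c q -> (exists s, gamma s = neck k q) <-> q.2 = 0.
Proof.
move=> Dq; split=> [/gamma_image|q2].
  have leg_case l k' x : q.1 != 0 -> leg k' (flip q) = leg l (x, 0) -> q.2 = 0.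
    move=> q0 /Cross_inj[wE tE].
    have dk := neck_dom_dcone theta k' q0 Dq; rewrite tE in dk.
    have x0 : x != 0.
      apply: contraTneq dk => ->; rewrite turn_origin /dcone /frame turn_origin /= normr0 mulr0.
      by rewrite ltxx.
    have [kl|kl] := eqVneq k' l; last by have := dcone_disjoint c1 sep kl wE dk (dcone_axis l x0).
    by move: tE; rewrite kl => /(can_inj (turnK _)) /(congr1 snd).
  case: (ltgtP q.1 0) => q0.
  - rewrite neck_lt0 // => -[[l //]|[l [x]]].
    by apply: leg_case; rewrite lt_eqF.
  - rewrite neck_gt0 // => -[[l //]|[l [x]]].
    by apply: leg_case; rewrite gt_eqF.
  - by case: q q0 {Dq leg_case} => x y /= ->; rewrite neck_eq0 => -[[l /Line_inj[]]|[l [x' //]]].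
case: q q2 {Dq} => x y /= ->; have [d hd <-] := tan_half_surj x.
by exists ((k%:Z)%:~R + d); rewrite gamma_neck // idx_nat.
Qed.

Lemma gamma_crossing s e : gamma s = Cross e (0, 0) ->
  exists z : int, s = z%:~R + half /\ w (idx z) = e.
Proof.
case: (param_cases s) => [[z [d hd ->]]|[z ->]]; last first.
  by rewrite gamma_half => /Cross_inj[<- _]; exists z.
have far k (x : R) : x != 0 -> leg k (x, 0) <> Cross e (0, 0).
  move=> x0 /Cross_inj[_ /(congr1 (fun p => turn p (- theta k)))].
  by rewrite turn_origin turnK => -[/eqP]; rewrite (negbTE x0).
rewrite gamma_neck //; case: (ltgtP (tan (pi * d)) 0) => t0.
- by rewrite neck_lt0 // => /far; rewrite flip_eq0 lt_eqF // => /(_ isT).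
- by rewrite neck_gt0 // => /far; rewrite flip_eq0 gt_eqF // => /(_ isT).
- by rewrite t0 neck_eq0.
Qed.

(** * The curve on the circle *)

Definition pt (s : R) : plane := (cos (2 * pi * s / N%:R), sin (2 * pi * s / N%:R)).
Definition circle_curve (p : plane) : Sigma := gamma (N%:R * arg p / (2 * pi)).
Local Notation f := circle_curve.

Lemma N_neq0 : N%:R != 0 :> R. Proof. by rewrite pnatr_eq0. Qed.

Lemma S1_pt s : S1 (pt s). Proof. exact: S1_cos_sin. Qed.

Lemma pt_eq s s' : pt s = pt s' -> exists y : int, s = s' + (N%:Z * y)%:~R.
Proof.
move=> [/angle_eq_mod H /H[y E1]]; exists y.
by rewrite intrM -pmulrn; exact: (scale_eq N_neq0 E1).
Qed.

Lemma pt_period s (y : int) : pt (s + (N%:Z * y)%:~R) = pt s.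
Proof.
rewrite /pt; have -> : 2 * pi * (s + (N%:Z * y)%:~R) / N%:R = 2 * pi * s / N%:R + 2 * pi * y%:~R.
  by rewrite intrM -pmulrn; exact: scale_period N_neq0.
by have [-> ->] := cos_sin_period (2 * pi * s / N%:R) y.
Qed.

Lemma f_pt s : f (pt s) = gamma s.
Proof.
have /pt_eq[y E1] : pt s = pt (N%:R * arg (pt s) / (2 * pi)).
  by rewrite [LHS](argK (S1_pt s)) /pt (scaleK _ N_neq0).
by rewrite [in RHS]E1 gamma_period.
Qed.

Lemma turn_pt s d : turn (pt s) d = pt (s + N%:R * d / (2 * pi)).
Proof.
by rewrite turn_cos_sin /pt (scaleD _ _ N_neq0).
Qed.

Lemma pt_surj p : S1 p -> exists s, p = pt s.
Proof.
by move=> /S1_angle[a _ ->]; exists (N%:R * a / (2 * pi)); rewrite /pt (scaleK _ N_neq0).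
Qed.

Lemma near_pt s (e : R) : 0 < e ->
  \forall p \near pt s, S1 p -> exists2 d, `|d| < e & p = pt (s + d).
Proof.
move=> e0; have p0 := two_pi_gt0 R; have N0 : 0 < N%:R :> R by rewrite ltr0n.
have e'0 : 0 < e * (2 * pi) / N%:R by rewrite divr_gt0 // mulr_gt0.
apply: filterS (S1_near (S1_pt s) e'0) => p H Sp; have [d hd ->] := H Sp.
exists (N%:R * d / (2 * pi)); last by rewrite turn_pt.
rewrite !normrM normfV (gtr0_norm N0) (gtr0_norm p0) ltr_pdivrMr //.
by move: hd; rewrite ltr_pdivlMr // mulrC.
Qed.

Lemma f_image a : (f @` @S1 R) a <-> exists s, gamma s = a.
Proof.
split=> [[p /pt_surj[s ->] <-]|[s <-]]; first by exists s; rewrite f_pt.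
by exists (pt s); [exact: S1_pt|rewrite f_pt].
Qed.

Lemma f_continuous : {within @S1 R, continuous f}.
Proof.
apply/subspace_continuousP => p /pt_surj[s ->] A nA0.
have nA : nbhs (gamma s) A by rewrite -f_pt; exact: nA0.
have := @continuous_gamma s A nA => /nbhs_ballP[e /= e0 He].
have := near_pt s e0; rewrite /within /=; apply: filterS => q H Sq.
have [d hd qE] := H Sq; change (A (f q)); rewrite qE f_pt; apply: He.
by rewrite /ball /= opprD addrA subrr add0r normrN.
Qed.

Lemma f_locally_injective : locally_injective f.
Proof.
move=> x /pt_surj[s ->].
have h0 : 0 < half by rewrite invr_gt0.
exists (fun p => S1 p -> exists2 d, `|d| < half & p = pt (s + d)); first exact: near_pt.
move=> p q /set_mem[Up Sp] /set_mem[Uq Sq].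
have [d hd ->] := Up Sp; have [d' hd' ->] := Uq Sq; rewrite !f_pt => E1.
have h1 := half_half.
have dd : `|d - d'| < 1 by apply: le_lt_trans (ler_normB _ _) _; rewrite -h1 ltrD.
have zero (y : int) : `|y%:~R : R| < 1 -> y = 0.
  by rewrite -intr_norm -[1]/(1%:~R) ltr_int; lia.
case: (gamma_inj E1) => [[y sE]|[z [z' [e1 e2 _]]]].
  have E2 : d - d' = (N%:Z * y)%:~R by move: sE; lra.
  by rewrite E2 in dd; move: sE; rewrite (zero _ dd) addr0 => ->.
have E2 : d - d' = (z - z')%:~R by rewrite intrB; move: e1 e2; lra.
rewrite E2 in dd; move: E2; rewrite (zero _ dd) => /eqP; rewrite subr_eq0 => /eqP -> //.
Qed.

Lemma fiber_regular s : (forall z : int, s <> z%:~R + half) ->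
  (@S1 R `&` f @^-1` [set gamma s] #= `I_1)%card.
Proof.
move=> ns; rewrite (_ : _ `&` _ = range (fun _ : unit => pt s)).
  by rewrite -card_unit; apply: card_image_finType => -[] [].
apply/seteqP; split => [p [/pt_surj[s' ->]]|_ [_ _ <-]]; last first.
  by split; [exact: S1_pt|exact: f_pt].
rewrite /= f_pt => /gamma_inj[[y ->]|[z [z' [_ /ns]]]] //.
by exists tt => //; rewrite pt_period.
Qed.

Variable o : 'I_N -> nat.
Definition mult (e : E) := #|[pred k | w k == e]|.
Hypothesis thetaE : forall k, theta k = (o k)%:R * pi / (mult (w k))%:R.
Hypothesis o_inj : forall k l, w k = w l -> o k = o l %[mod mult (w k)] -> k = l.

Lemma mult_gt0 k : (0 < mult (w k))%N.
Proof. by apply/card_gt0P; exists k; rewrite inE. Qed.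

Lemma pt_half (k : 'I_N) z : idx z = k -> pt (z%:~R + half) = pt ((k%:Z)%:~R + half).
Proof.
move=> zk; have [y ->] := idx_eq (etrans zk (esym (idx_nat k))).
by rewrite intrD addrAC pt_period.
Qed.

Lemma fiber_crossing e : (@S1 R `&` f @^-1` [set Cross e (0, 0)] #= `I_(mult e))%card.
Proof.
pose L : finType := {k : 'I_N | w k == e}.
have <- : #|L| = mult e by rewrite card_sig.
rewrite (_ : _ `&` _ = range (fun l : L => pt ((val l : nat)%:Z%:~R + half))).
  apply: card_image_finType => l l' /pt_eq[y E1]; apply/val_inj.
  rewrite -(idx_nat (val l)) -(idx_nat (val l')).
  have -> : ((val l : nat)%:Z = (val l' : nat)%:Z + N%:Z * y)%R.
    by apply/eqP; rewrite -(eqr_int R) intrD; apply/eqP; move: E1; lra.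
  exact: idx_period.
apply/seteqP; split => [p [/pt_surj[s ->]]|_ [l _ <-]].
  rewrite /= f_pt => /gamma_crossing[z [-> we]].
  have zL : w (idx z) == e by apply/eqP.
  by exists (exist _ (idx z) zL) => //=; rewrite (pt_half (k := idx z)).
split; first exact: S1_pt.
by rewrite /= f_pt gamma_half idx_nat (eqP (valP l)).
Qed.

(** Pigeonhole: a crossing has as many branches as there are residues. *)
Lemma residue_attained k0 j : (j < mult (w k0))%N -> exists2 k, w k = w k0 & o k = j %[mod mult (w k0)].
Proof.
set m := mult (w k0) => jm; have m0 : (0 < m)%N by exact: mult_gt0.
pose L : finType := {k : 'I_N | w k == w k0}.
have cL : #|L| = m by rewrite card_sig.
pose F (l : L) : 'I_m := Ordinal (ltn_pmod (o (val l)) m0).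
have F_inj : injective F.
  move=> l l' /(congr1 val) /= E1; apply/val_inj; apply: o_inj.
    by rewrite (eqP (valP l)) (eqP (valP l')).
  by rewrite (eqP (valP l)).
have [G _ FG] : bijective F by apply: inj_card_bij => //; rewrite cL card_ord.
exists (val (G (Ordinal jm))); first exact/eqP/(valP (G (Ordinal jm))).
by have := congr1 val (FG (Ordinal jm)); rewrite /= [(j %% m)%N]modn_small.
Qed.

(** The branches have directions [j pi / m], one for each residue of [j] modulo
    [m]: they form the whole star. *)
Lemma cross_on_curve k0 p : (exists s, gamma s = Cross (w k0) p) <->
  complex.Im (Complex p.1 p.2 ^+ mult (w k0)) = 0.
Proof.
have m0 := mult_gt0 k0; have m0' : (mult (w k0))%:R != 0 :> R by rewrite pnatr_eq0 -lt0n.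
split=> [/gamma_image[[k //]|[k [x /Cross_inj[we ->]]]]|].
  rewrite we turn_axis thetaE -we /polar /= !add0r de_Moivre /=.
  by rewrite [(mult _)%:R * _]mulrC divfK // sin_natpi mulr0.
move=> /(star_lines p m0)[j [x [jm ->]]]; apply/gamma_image; right.
have [k wk ok] := residue_attained jm.
have [d dE] : exists d : nat, (o k = j + d * mult (w k0))%N.
  by exists (o k %/ mult (w k0))%N; rewrite {1}(divn_eq (o k) (mult (w k0))) ok (modn_small jm) addnC.
exists k, (x * (-1) ^+ d).
have -> : leg k (x * (-1) ^+ d, 0) = Cross (w k0) (turn (x * (-1) ^+ d, 0) (theta k)).
  by rewrite /leg wk.
congr Cross; rewrite turn_axis.
have -> : theta k = j%:R * pi / (mult (w k0))%:R + d%:R * pi.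
  by rewrite thetaE wk dE natrD natrM; field.
elim: d {dE} => [|d IH]; first by rewrite expr0 mulr1 mul0r addr0.
have -> : x * (-1) ^+ d.+1 = - (x * (-1) ^+ d) by rewrite exprS mulN1r mulrN.
rewrite IH -[x * (-1) ^+ d in LHS]opprK [LHS]polarNr -addrA; congr (polar _ _ (_ + _)).
by rewrite -natr1 mulrDl mul1r.
Qed.

Lemma star_crossing k0 : star_nbhd f (Cross (w k0) (0, 0) : Sigma) (mult (w k0))
  ((Cross (w k0) \o blow (0, 0) 1) @` @disc R)
  (shrink (0, 0) 1 \o (@param_inv R E n w theta c (inl (w k0)))) (Cross (w k0) \o blow (0, 0) 1).
Proof.
apply: (star_nbhd_of_disc (Sigma := Sigma) (D := setT)) => //.
- exact: continuous_Cross.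
- exact: open_Cross.
- exact: openT.
- move=> p _; have -> : blow (0, 0) 1 p = p :> plane by rewrite /blow !add0r !mul1r; case: (p).
  by rewrite -cross_on_curve; exact: f_image.
Qed.

Lemma regular_in_neck s : (forall z : int, s <> z%:~R + half) ->
  exists k u, gamma s = neck k (u, 0).
Proof.
move=> ns; case: (param_cases s) => [[z [d hd ->]]|[z /ns //]].
by exists (idx z), (tan (pi * d)); rewrite gamma_neck.
Qed.

Lemma star_regular s : (forall z : int, s <> z%:~R + half) ->
  exists V h g, star_nbhd f (gamma s : Sigma) 1 V h g.
Proof.
move=> /regular_in_neck[k [u ->]].
have Du : neck_dom c (u, 0) by apply: neck_dom_axis; right.
have := open_nbhs_nbhs (conj (@open_neck_dom R c) Du) => /nbhs_box[e e0 He].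
pose r := e / 2; have r0 : 0 < r by rewrite divr_gt0.
have re : r < e by rewrite /r; lra.
have discD (p : plane) : disc p -> neck_dom c (blow (u, 0) r p).
  rewrite /disc /= => hp; have h1 := sqr_ge0 p.1; have h2 := sqr_ge0 p.2.
  have bound (x : R) : x ^+ 2 <= 1 -> `|r * x| < e.
    move=> hx; have x1 : `|x| <= 1 by rewrite -(@expr_le1 _ 2) // real_normK ?num_real.
    by rewrite normrM (gtr0_norm r0); apply: le_lt_trans re; rewrite ler_piMr // ltW.
  apply: He; rewrite /blow /=; [rewrite addrAC subrr add0r|rewrite add0r subr0].
    by apply: bound; lra.
  by apply: bound; lra.
exists ((neck k \o blow (u, 0) r) @` @disc R).
exists (shrink (u, 0) r \o @param_inv R E n w theta c (inr k)), (neck k \o blow (u, 0) r).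
apply: (star_nbhd_of_disc (Sigma := Sigma) (g := neck k) (h := @param_inv R E n w theta c (inr k)) (q := (u, 0)) (r := r) (D := neck_dom c)) => //.
- exact: continuous_neck.
- exact: open_neck.
- exact: open_neck_dom.
- by move=> p Dp; exact: neckK.
- move=> p /discD Dp; rewrite expr1 /=; apply: iff_trans (f_image _) _.
  apply: iff_trans (neck_on_curve k Dp) _; rewrite /blow /= add0r.
  by split=> [/eqP|->]; rewrite ?mulr0 // mulf_eq0 gt_eqF //= => /eqP.
Qed.

Lemma multiplicity_crossing k : has_multiplicity f (Cross (w k) (0, 0) : Sigma) (mult (w k)).
Proof.
split; first exact: mult_gt0.
- by do 3 eexists; exact: star_crossing.
- exact: fiber_crossing.
Qed.

Lemma half_or_not s : (exists z : int, s = z%:~R + half) \/ (forall z : int, s <> z%:~R + half).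
Proof.
have [h|h] := pselect (exists z : int, s = z%:~R + half); first by left.
by right=> z E1; apply: h; exists z.
Qed.

Lemma f_tame : tame f.
Proof.
split; first exact: f_continuous.
- by move=> a _; rewrite glued_boundary.
- exact: f_locally_injective.
move=> a /f_image[s <-]; case: (half_or_not s) => [[z ->]|ns].
  by exists (mult (w (idx z))); rewrite gamma_half; exact: multiplicity_crossing.
exists 1%N; split=> //; first exact: star_regular.
exact: fiber_regular.
Qed.

Lemma crossingsP a : crossings f a <-> exists k, a = Cross (w k) (0, 0) /\ (1 < mult (w k))%N.
Proof.
split=> [[/f_image[s <-] [m m1 [_ _ cm]]]|[k [-> m1]]]; last first.
  split; last by exists (mult (w k)) => //; exact: multiplicity_crossing.
  by apply/f_image; exists ((k%:Z)%:~R + half); rewrite gamma_half idx_nat.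
case: (half_or_not s) => [[z zE]|ns].
  exists (idx z); rewrite zE gamma_half; split=> //.
  move: cm; rewrite zE gamma_half => cm.
  by have /card_eq_II <- := card_eq_trans (card_esym cm) (fiber_crossing _).
have /card_eq_II E1 := card_eq_trans (card_esym cm) (fiber_regular ns).
by rewrite E1 in m1.
Qed.

(** * Corners, base point and transversality *)

Definition simple_points (b : bool) : set Sigma :=
  [set a | b /\ exists k, a = Cross (w k) (0, 0) /\ mult (w k) = 1%N].

Lemma simple_points_finite b : finite_set (simple_points b).
Proof.
apply: (@sub_finite_set _ _ (range (fun k => Cross (w k) (0, 0) : Sigma))).
  by move=> a [_ [k [-> _]]]; exists k.
by apply: finite_image; exact: finite_finset.
Qed.

Lemma simple_points_sub b : simple_points b `<=` (f @` @S1 R) `\` crossings f.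
Proof.
move=> a [_ [k [-> m1]]]; split.
  by apply/f_image; exists ((k%:Z)%:~R + half); rewrite gamma_half idx_nat.
by move=> /crossingsP[l [/Cross_inj[<- _]]]; rewrite m1.
Qed.

(** The boolean tells whether the simple points of the crossing planes are
    corners. *)
Definition cornered_curve b : curve Sigma :=
  Curve f_tame (simple_points_finite b) (@simple_points_sub b).

Lemma cr_sub b a : cr (cornered_curve b) a -> exists k, a = Cross (w k) (0, 0).
Proof. by move=> [[_ [k [-> _]]]|/crossingsP[k [-> _]]]; exists k. Qed.

Lemma cr_true k : cr (cornered_curve true) (Cross (w k) (0, 0)).
Proof.
have := mult_gt0 k; rewrite leq_eqVlt => /orP[/eqP m1|m1].
  by left; split=> //; exists k.
by right; apply/crossingsP; exists k.
Qed.

Lemma base_regular b : ~ sing (cornered_curve b) (pt 0).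
Proof.
move=> [_ /cr_sub[k]]; rewrite /= f_pt.
by rewrite -[0]/(0%:~R) gamma_int.
Qed.

Definition based_curve b : pointed_curve Sigma := PointedCurve (S1_pt 0) (@base_regular b).

Definition crossing_time (k : 'I_N) : R := (k%:Z)%:~R + half.

Lemma sing_true p : sing (cornered_curve true) p <-> exists k, p = pt (crossing_time k).
Proof.
split=> [[/pt_surj[s ->] /cr_sub[k]]|[k ->]].
  rewrite /= f_pt => /gamma_crossing[z [-> _]].
  by exists (idx z); rewrite (pt_half (k := idx z)).
split; first exact: S1_pt.
by rewrite /= f_pt gamma_half idx_nat; exact: cr_true.
Qed.

Lemma pt_crossing_inj k l : pt (crossing_time k) = pt (crossing_time l) -> k = l.
Proof.
move=> /pt_eq[y E1]; rewrite -(idx_nat k) -(idx_nat l).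
have -> : ((k : nat)%:Z = (l : nat)%:Z + N%:Z * y)%R.
  apply/eqP; rewrite -(eqr_int R) intrD; apply/eqP.
  by move: E1; rewrite /crossing_time; lra.
exact: idx_period.
Qed.

Lemma gamma_branch k d : `|d| < half -> gamma (crossing_time k + d) = leg k (tan (pi * d), 0).
Proof.
rewrite ltr_norml => /andP[h1 h2]; have half1 := half_half.
rewrite /crossing_time -addrA gamma_leg ?idx_nat; last by apply/andP; split; lra.
by rewrite addrAC subrr add0r.
Qed.

(** Linear coordinates in which the branches [k] and [l] are the axes. *)
Definition skew k l (z : plane) : plane := ((frame theta l z).2, (frame theta k z).2).

Definition unskew k l (p : plane) : plane :=
  turn ((p.1 - p.2 * cos (theta k - theta l)) / sin (theta k - theta l), p.2) (theta k).

Lemma skew_frame k l z : skew k l z =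
  ((frame theta k z).1 * sin (theta k - theta l) + (frame theta k z).2 * cos (theta k - theta l),
   (frame theta k z).2).
Proof.
have -> : skew k l z = ((turn (frame theta k z) (theta k - theta l)).2, (frame theta k z).2).
  by rewrite /skew /frame turnD; congr ((turn _ _).2, _); ring.
by [].
Qed.

Lemma sin_neq0 k l : k != l -> w k = w l -> sin (theta k - theta l) != 0.
Proof.
move=> kl wkl; apply/eqP => s0; have := sep kl wkl.
by rewrite s0 normr0 mulr0 lern0.
Qed.

Lemma unskewK k l : k != l -> w k = w l -> cancel (unskew k l) (skew k l).
Proof.
move=> kl wkl [p q]; rewrite skew_frame /unskew turn_frameK /=.
by rewrite divfK ?sin_neq0 // subrK.
Qed.

Lemma skewK k l : k != l -> w k = w l -> cancel (skew k l) (unskew k l).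
Proof.
move=> kl wkl z; rewrite skew_frame -[RHS](@frameK R n theta k z).
by case: (frame theta k z) => u v; rewrite /unskew /= addrK mulfK ?sin_neq0.
Qed.

Lemma continuous_skew k l : continuous (skew k l).
Proof.
move=> z; apply: continuous_plane.
  exact: (continuous_comp (@continuous_frame R n theta l z) (@continuous_snd_at R _)).
exact: (continuous_comp (@continuous_frame R n theta k z) (@continuous_snd_at R _)).
Qed.

Lemma continuous_unskew k l : continuous (unskew k l).
Proof.
move=> p; apply: (@continuous_comp _ _ _
  (fun p : plane => ((p.1 - p.2 * cos (theta k - theta l)) / sin (theta k - theta l), p.2))
  (fun p => turn p (theta k))); last exact: continuous_turn.
apply: continuous_plane; last exact: cvg_snd.
apply: cvgM; last exact: cvg_cst.
by apply: cvgB; [exact: cvg_fst|apply: cvgM; [exact: cvg_snd|exact: cvg_cst]].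
Qed.

Lemma cornered_curve_transversal b : self_transversal (cornered_curve b).
Proof.
move=> a x y cra /pt_surj[s ->] /pt_surj[s' ->] xy fx fy.
have : cr (cornered_curve b) a by right.
move=> /cr_sub[k0 aE]; move: fx fy; rewrite aE /= !f_pt => /gamma_crossing[z [zs wz]] /gamma_crossing[z' [zs' wz']].
have ptE u : pt (u%:~R + half) = pt (crossing_time (idx u)) by rewrite (pt_half (k := idx u)).
move: xy; rewrite zs zs' (ptE z) (ptE z') => xy.
move: (idx z) (idx z') wz wz' xy => k l {zs zs'} wk wl xy.
have kl : k != l by apply/eqP => e; apply: xy; rewrite e.
have wkl : w k = w l by rewrite wk wl.
have oG O : open O -> open ((Cross (w k0) \o unskew k l) @` O).
  move=> oO; rewrite -image_comp; apply: open_Cross.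
  rewrite (_ : _ @` _ = skew k l @^-1` O); first by apply: open_comp => // p _; exact: continuous_skew.
  apply/seteqP; split => p /=; first by move=> [u Ou <-]; rewrite unskewK.
  by move=> Op; exists (skew k l p); rewrite ?skewK.
have near_branch m (i : plane -> R) : w m = w k0 ->
    (forall u : R, i (skew k l (turn (u, 0) (theta m))) = 0) ->
    \forall p \near within (@S1 R) (nbhs (pt (crossing_time m))),
      ((Cross (w k0) \o unskew k l) @` setT) (f p) /\
      i ((skew k l \o @param_inv R E n w theta c (inl (w k0))) (f p)) = 0.
  move=> wm ax; have h0 : 0 < half by rewrite invr_gt0.
  have := near_pt (crossing_time m) h0; rewrite /within /=; apply: filterS => p H Sp.
  have [d hd ->] := H Sp; rewrite f_pt gamma_branch //.
  have -> : leg m (tan (pi * d), 0) = Cross (w k0) (turn (tan (pi * d), 0) (theta m)) by rewrite /leg wm.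
  split; last exact: ax.
  exists (skew k l (turn (tan (pi * d), 0) (theta m))) => //=.
  by rewrite skewK.
exists ((Cross (w k0) \o unskew k l) @` setT).
exists (skew k l \o @param_inv R E n w theta c (inl (w k0))), (Cross (w k0) \o unskew k l).
split.
- apply: open_nbhs_nbhs; split; first by apply: oG; exact: openT.
  by exists (skew k l (0, 0)) => //=; rewrite skewK.
- apply: homeo_on_open_image => //.
  + move=> p; apply: (@continuous_comp _ _ _ (unskew k l) (Cross (w k0))).
      exact: continuous_unskew.
    exact: continuous_Cross.
  + exact: openT.
  + by move=> p _; rewrite /= unskewK.
- by apply: (near_branch k snd) => // u; exact: (congr1 snd (turn_frameK theta k (u, 0))).
- by apply: (near_branch l fst) => // u; exact: (congr1 snd (turn_frameK theta l (u, 0))).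
Qed.

(** * The word of the curve *)

(** The number of the ray of a flag, up to full turns. *)
Definition flag_pos (k : 'I_N) (b : bool) : nat := (o k + (if b then 0 else mult (w k)))%N.

Lemma flag_on_pos k b : flag_on_ray (cornered_curve true)
  (shrink (0, 0) 1 \o @param_inv R E n w theta c (inl (w k))) (mult (w k)) (flag_pos k b)
  (pt (crossing_time k), b).
Proof.
have p0 := two_pi_gt0 R; have N0 : 0 < N%:R :> R by rewrite ltr0n.
have e0 : 0 < half * (2 * pi) / N%:R by rewrite divr_gt0 // mulr_gt0 ?invr_gt0.
have m0' : (mult (w k))%:R != 0 :> R by rewrite pnatr_eq0 -lt0n mult_gt0.
rewrite /flag_on_ray; near=> s.
have s0 : 0 < s by near: s; exact: nbhs_right_gt.
have se : s < half * (2 * pi) / N%:R by near: s; exact: nbhs_right_lt.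
pose d := N%:R * s / (2 * pi).
have d0 : 0 < d by rewrite divr_gt0 // mulr_gt0.
have d2 : `|d| < half.
  by rewrite gtr0_norm // ltr_pdivrMr // mulrC; move: se; rewrite ltr_pdivlMr.
have [t1 _] := tan_half_sg d2.
have t0 : 0 < tan (pi * d) by rewrite t1.
have shrink_id (p : plane) : shrink (0, 0) 1 p = p.
  by rewrite /shrink /= !subr0 !divr1; case: (p).
exists (tan (pi * d)) => //; rewrite /flag_pos; case: b => /=.
  rewrite turn_pt -/d f_pt gamma_branch // /= shrink_id turn_axis thetaE.
  by rewrite addn0.
have -> : turn (pt (crossing_time k)) (- s) = pt (crossing_time k + - d).
  by rewrite turn_pt /d mulrN mulNr.
rewrite f_pt gamma_branch ?normrN // /= shrink_id turn_axis mulrN tanN polarNr thetaE.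
by congr polar; rewrite natrD; field.
Unshelve. all: by end_near. Qed.

Lemma next_flag k b : exists l b', w l = w k /\
  flag_pos l b' = (flag_pos k b).+1 %[mod mult (w k) + mult (w k)].
Proof.
set m := mult (w k); have m0 : (0 < m)%N by exact: mult_gt0.
pose j := ((flag_pos k b).+1 %% (m + m))%N.
have j2 : (j < m + m)%N by rewrite ltn_pmod // addn_gt0 m0.
have [l wl ol] := residue_attained (ltn_pmod j m0).
rewrite -/m modn_mod in ol; exists l; rewrite /flag_pos wl -/m.
have ol2 : (o l %% (m + m) < m + m)%N by rewrite ltn_pmod // addn_gt0 m0.
have olm : ((o l %% (m + m)) %% m = j %% m)%N.
  by rewrite modn_dvdm ?dvdn_add.
have [e|e] : (o l %% (m + m) = j)%N \/ ((o l %% (m + m) + m) %% (m + m) = j)%N.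
  move: (o l %% (m + m))%N ol2 olm => i i2 ij.
  have red u : (u < m + m)%N -> u = (u %% m)%N \/ u = (u %% m + m)%N.
    move=> u2; case: (ltnP u m) => um; first by left; rewrite modn_small.
    right; rewrite -{2}(subnK um) modnDr modn_small ?subnK //; lia.
  case: (red i i2) => ei; case: (red j j2) => ej.
  - by left; rewrite ei ej.
  - right; rewrite modn_small; first by rewrite ei ej ij.
    have := ltn_pmod i m0; lia.
  - right; have -> : (i + m = i %% m + (m + m))%N by lia.
    by rewrite modnDr modn_small; [rewrite ij -ej|have := ltn_pmod i m0; lia].
  - by left; rewrite ei ej ij.
- by exists true; split=> //; rewrite addn0 e /j.
- by exists false; split=> //; rewrite -modnDml e /j.
Qed.

(** The flags at a crossing lie on the rays numbered by [flag_pos], so that the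
    rotation is determined by the numbers modulo a full turn. *)
Lemma word_realized (S : {set 'I_N}) :
  (forall e, exists k, w k = e) ->
  (forall k l b, w l = w k ->
     flag_pos l b = (o k).+1 %[mod mult (w k) + mult (w k)] -> (k \in S) = ~~ b) ->
  realized_by (Word w S) (based_curve true).
Proof.
move=> w_full mark.
have crE (e : E) : (Cross e (0, 0) : Sigma) \in cr (based_curve true).
  by apply/mem_set; have [k <-] := w_full e; exact: cr_true.
pose psi (e : E) : set_type (cr (based_curve true)) := exist (fun a => a \in cr (based_curve true)) _ (crE e).
exists (Word (fun k => psi (w k)) S); last first.
  exists erefl; split=> /= [k|]; first by rewrite cast_ord_id.
  exists psi; last by move=> k; rewrite cast_ord_id.
  pose inv (a : set_type (cr (based_curve true))) : E :=
    match (val a : glued w theta) with CrossPoint e _ => e | LinePoint _ _ => w ord0 end.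
  exists inv => // a; apply/val_inj; rewrite /inv.
  by have [k ->] := cr_sub (set_mem (valP a)).
pose t (k : 'I_N) : R := 2 * pi * crossing_time k / N%:R.
have N0 : 0 < N%:R :> R by rewrite ltr0n.
have p0 := two_pi_gt0 R.
have turn_t k : turn (pt 0) (t k) = pt (crossing_time k).
  rewrite turn_pt add0r /t; congr pt; rewrite [N%:R * _]mulrC divfK ?gt_eqF //.
  by rewrite mulrC mulKf ?gt_eqF.
have /choice[rho rhoP] : forall phi : flag R, exists phi' : flag R,
    forall k b, phi = (pt (crossing_time k), b) ->
    exists l b', [/\ phi' = (pt (crossing_time l), b'), w l = w k &
      flag_pos l b' = (flag_pos k b).+1 %[mod mult (w k) + mult (w k)]].
  move=> phi.
  have [[k [b ->]]|no] := pselect (exists k b, phi = (pt (crossing_time k), b)).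
    have [l [b' [wl El]]] := next_flag k b.
    exists (pt (crossing_time l), b') => k' b0 E1.
    have <- := pt_crossing_inj (congr1 fst E1); have <- : b = b0 := congr1 snd E1.
    by exists l, b'.
  by exists phi => k b E1; exfalso; apply: no; exists k, b.
exists t, rho; split=> /=.
- move=> k; have half1 := half_half; have h0 : 0 < half by rewrite invr_gt0.
  have k0 : 0 <= (k%:Z)%:~R :> R by rewrite ler0z.
  have kN : (k%:Z)%:~R + 1 <= N%:R :> R by rewrite -pmulrn natr1 ler_nat.
  have ct : 0 < crossing_time k by rewrite /crossing_time; lra.
  rewrite /t; apply/andP; split; first by rewrite divr_gt0 // mulr_gt0.
  rewrite ltr_pdivrMr // ltr_pM2l //.
  by rewrite /crossing_time; lra.
- move=> k l kl; rewrite /t ltr_pM2r ?invr_gt0 // ltr_pM2l // /crossing_time ltrD2r.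
  by rewrite ltr_int ltz_nat.
- apply/seteqP; split => [_ [k _ <-]|p /sing_true[k ->]].
    by apply/sing_true; exists k; exact: turn_t.
  by exists k => //; exact: turn_t.
- by move=> k; rewrite turn_t /= f_pt gamma_half idx_nat.
split; last first.
  move=> k; rewrite turn_t; have [l [b [-> wl El]]] := rhoP _ k true erefl.
  by apply: (mark k l b wl); rewrite El /flag_pos addn0.
move=> _ /cr_sub[k0 ->]; exists (mult (w k0)).
exists ((Cross (w k0) \o blow (0, 0) 1) @` @disc R).
exists (shrink (0, 0) 1 \o (@param_inv R E n w theta c (inl (w k0)))), (Cross (w k0) \o blow (0, 0) 1).
split; [exact: multiplicity_crossing|exact: star_crossing| |].
  move=> c' at_c' dom_c'.
  have -> : chart_map c' \o (Cross (w k0) \o blow (0, 0) 1) = chart_map c' \o @param R E n w theta (inl (w k0)).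
    by apply/funext => p; rewrite /= /blow !add0r !mul1r; case: (p).
  have H := @param_positive R E n w theta c c1 sep (inl (w k0)) (0, 0) c' I at_c' dom_c'.
  exact H.
move=> [x b] [/sing_true[/= k ->]]; rewrite /= f_pt gamma_half idx_nat => /Cross_inj[wk _].
have [l [b' [rE wl El]]] := rhoP _ k b erefl; rewrite rE; split.
  split; first by apply/sing_true; exists l.
  by rewrite /= f_pt gamma_half idx_nat wl wk.
exists (flag_pos k b); rewrite -wk; split; first exact: flag_on_pos.
rewrite /flag_on_ray (ray_mod R (mult_gt0 k) (esym El)) -wl.
exact: flag_on_pos.
Qed.

Lemma cr_false : (forall k, mult (w k) = 1%N) -> cr (based_curve false) = set0.
Proof.
move=> m1; apply/seteqP; split=> // a [[]//|/crossingsP[k [_]]].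
by rewrite m1.
Qed.

End Curve.

(** * Arrangement of the branches at a crossing *)

Section Arrangement.
Local Open Scope nat_scope.
Variables (E : finType) (n : nat) (w : 'I_n.+1 -> E) (S : {set 'I_n.+1}).
Hypothesis oddS : forall k, odd #|[pred l | (l \in S) && (w k == w l)]|.

Definition marked e := enum [pred l | (l \in S) && (e == w l)].
Definition unmarked e := enum [pred l | (l \notin S) && (e == w l)].
Definition rank (k : 'I_n.+1) := index k (marked (w k) ++ unmarked (w k)).

(** The number of the outgoing ray. Along the first half turn the flags alternate,
    starting with an incoming one, as long as there are marked places, and are
    outgoing from then on. As the number of marked places is odd, this
    alternation ends with an incoming flag, and exactly the outgoing flags of the
    marked places are followed by incoming ones. *)
Definition direction (k : 'I_n.+1) : nat :=
  rank k + (if (rank k < size (marked (w k))) && ~~ odd (rank k) then mult w (w k) else 0).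

Lemma mem_marked_cat k l : w l = w k -> l \in marked (w k) ++ unmarked (w k).
Proof. by move=> wl; rewrite mem_cat !mem_enum !inE wl eqxx !andbT orbN. Qed.

Lemma size_marked_cat e : size (marked e ++ unmarked e) = mult w e.
Proof.
rewrite size_cat -!cardE /mult -(cardID [pred l | l \in S] [pred l | w l == e]).
by congr addn; apply: eq_card => l; rewrite !inE eq_sym // andbC.
Qed.

Lemma rank_lt k : (rank k < mult w (w k))%N.
Proof. by rewrite -size_marked_cat index_mem mem_marked_cat. Qed.

Lemma rank_inj k l : w k = w l -> rank k = rank l -> k = l.
Proof.
move=> wkl; have hk := nth_index k (mem_marked_cat (erefl (w k))).
have hl := nth_index k (mem_marked_cat (esym wkl)).
by rewrite /rank -wkl => E1; rewrite -[LHS]hk E1 hl.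
Qed.

Lemma rank_marked k : (rank k < size (marked (w k)))%N = (k \in S).
Proof.
rewrite /rank index_cat; case: ifP => [km|/negbT km].
  by rewrite index_mem km; move: km; rewrite mem_enum !inE => /andP[->].
rewrite ltnNge leq_addr; move: km; rewrite mem_enum !inE eqxx andbT.
by move=> /negbTE ->.
Qed.

Lemma odd_marked k : odd (size (marked (w k))).
Proof. by rewrite -cardE; exact: oddS. Qed.

Lemma direction_inj k l : w k = w l -> direction k = direction l %[mod mult w (w k)] -> k = l.
Proof.
move=> wkl; have dir_mod i : direction i = rank i %[mod mult w (w i)].
  by rewrite /direction; case: ifP => _; rewrite ?addn0 ?modnDr.
rewrite dir_mod wkl dir_mod -wkl modn_small ?rank_lt // [in RHS]wkl modn_small ?rank_lt //.
exact: rank_inj.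
Qed.

Lemma eq_mod_cases M x y : x < M + M -> y < M + M -> x = y %[mod M] ->
  [\/ x = y, x = y + M | y = x + M]%N.
Proof.
have red z : z < M + M -> z = z %% M \/ z = z %% M + M.
  move=> zM; case: (ltnP z M) => h; first by left; rewrite modn_small.
  by right; rewrite -{2}(subnK h) modnDr modn_small ?subnK //; lia.
move=> xM yM E1; case: (red x xM) => ex; case: (red y yM) => ey.
- by apply: Or31; rewrite ex ey.
- by apply: Or33; rewrite ex ey E1.
- by apply: Or32; rewrite ex ey E1.
- by apply: Or31; rewrite ex ey E1.
Qed.

(** Here [i] and [j] are the ranks of two branches among the [m] at a crossing, of
    which the first [r] are marked; the flag [b] of [j] follows the outgoing flag
    of [i]. *)
Lemma alternate_then_outgoing (m r i j : nat) (b : bool) : i < m -> j < m -> odd r -> r <= m ->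
  j + (if (j < r) && ~~ odd j then m else 0) + (if b then 0 else m) =
  (i + (if (i < r) && ~~ odd i then m else 0)).+1 %[mod m + m] ->
  (i < r) = ~~ b.
Proof.
move=> im jm or rm /eq_mod_cases H.
have := odd_double_half i; have := odd_double_half j; have := odd_double_half r.
move: H; rewrite or.
case: (odd i); case: (odd j); case: b; case: (ltnP i r) => ir; case: (ltnP j r) => jr //= H ed1 ed2 ed3;
  exfalso; case: H => [| |H|H|H]; lia.
Qed.

Lemma direction_marks k l b : w l = w k ->
  flag_pos w direction l b = (direction k).+1 %[mod mult w (w k) + mult w (w k)] ->
  (k \in S) = ~~ b.
Proof.
rewrite -rank_marked /flag_pos /direction => wl; rewrite wl => H.
apply: alternate_then_outgoing H; first exact: rank_lt.
- by rewrite -wl; exact: rank_lt.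
- exact: odd_marked.
- by rewrite -size_marked_cat size_cat leq_addr.
Qed.

End Arrangement.

(** * The characterization *)

Section Realization.
Variable R : realType.

Lemma odd_word_realized (E : finType) (W : word E) : full W -> odd_word W ->
  exists (Sigma : surface R) (f : pointed_curve Sigma), self_transversal f /\ realized_by W f.
Proof.
case: W => [[|n] w S] /= w_full oddS.
  (* a curve with one simple point, which is not made a corner, has the empty word *)
  have c1 : 1 <= 1 :> R by [].
  have sep : forall k l : 'I_1, k != l -> tt = tt -> 3 <= 1 * `|sin (0 - 0 : R)|.
    by move=> k l; rewrite !ord1.
  have thetaE : forall k : 'I_1, 0 = 0%:R * pi / (mult (fun _ : 'I_1 => tt) tt)%:R :> R.
    by move=> k; rewrite !mul0r.
  have o_inj : forall k l : 'I_1, tt = tt -> 0 = 0 %[mod mult (fun _ : 'I_1 => tt) tt] -> k = l.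
    by move=> k l; rewrite !ord1.
  pose f := @based_curve R unit 0 (fun _ => tt) (fun _ => 0) 1 c1 sep (fun _ => 0%N) thetaE o_inj false.
  exists (glued_surface c1 sep), f; split; first exact: cornered_curve_transversal.
  have cr0 : cr f = set0.
    apply: cr_false => k; rewrite /mult -[RHS](card_ord 1).
    by apply: eq_card => l; rewrite !inE.
  exists (Word (fun k : 'I_0 => False_rect (set_type (cr f)) (notF (ltn_ord k))) finset.set0).
    exists (fun _ => 0), id; split=> /=; try by case.
    + apply/seteqP; split => [_ [[]//]|p [_]].
      by rewrite /= cr0.
    + by split=> [a|[]//]; rewrite cr0.
  exists erefl; split=> /=; first by case.
  have noE (e : E) : False by have [[]] := w_full e.
  exists (fun e => False_rect _ (noE e)); last by case.
  have no_cr0 x : ~ cr f x by rewrite cr0.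
  have no_cr (a : set_type (cr f)) : False := no_cr0 _ (set_mem (valP a)).
  by exists (fun a => False_rect _ (no_cr a)) => [e|a]; [case: (noE e)|case: (no_cr a)].
have {}oddS k : odd #|[pred l | (l \in S) && (w k == w l)]| by exact: oddS.
pose o := direction w S.
pose theta k : R := (o k)%:R * pi / (mult w (w k))%:R.
have o_inj : forall k l, w k = w l -> o k = o l %[mod mult w (w k)] -> k = l.
  by move=> k l; exact: direction_inj.
(* parallel branches contribute 0, the inverse of 0 being 0 *)
pose c : R := 1 + \sum_(k < n.+1) \sum_(l < n.+1) 3 / `|sin (theta k - theta l)|.
have term_ge0 k l : 0 <= 3 / `|sin (theta k - theta l)| by rewrite divr_ge0.
have row_ge0 k : 0 <= \sum_(l < n.+1) 3 / `|sin (theta k - theta l)|.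
  by apply: sumr_ge0 => l _; exact: term_ge0.
have c1 : 1 <= c by rewrite lerDl; apply: sumr_ge0 => k _; exact: row_ge0.
have sep : forall k l, k != l -> w k = w l -> 3 <= c * `|sin (theta k - theta l)|.
  move=> k l kl wkl.
  have s0 : 0 < `|sin (theta k - theta l)|.
    rewrite normr_gt0; apply/eqP => /sin_eq0[z].
    have m0 : (mult w (w k))%:R != 0 :> R by rewrite pnatr_eq0 -lt0n mult_gt0.
    have p0 : pi != 0 :> R by rewrite gt_eqF // pi_gt0.
    rewrite /theta -wkl -!mulrBl => H.
    have {}H : (o k)%:R - (o l)%:R = z%:~R * (mult w (w k))%:R :> R.
      apply: (mulIf p0); move/(congr1 ( *%R^~ (mult w (w k))%:R)): H.
      by rewrite /= divfK // => ->; rewrite mulrAC.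
    move/eqP: kl; apply; apply: o_inj => //.
    have {}H : (o k : int) = (o l : int) + z * (mult w (w k) : int).
      by apply/eqP; rewrite -(eqr_int R) intrD intrM -!pmulrn -H addrC subrK.
    by apply/eqP; rewrite -eqz_nat -!modz_nat H addrC modzMDl.
  rewrite -ler_pdivrMr // /c; apply: ler_wpDl => //.
  rewrite (bigD1 k) //= (bigD1 l) //= -addrA lerDl addr_ge0 //.
    by apply: sumr_ge0.
  by apply: sumr_ge0.
have thetaE k : theta k = (o k)%:R * pi / (mult w (w k))%:R by [].
exists (glued_surface c1 sep), (based_curve c1 sep thetaE o_inj true).
split; first exact: cornered_curve_transversal.
apply: word_realized; first by move=> e; have [k <-] := w_full e; exists k.
by move=> k l b; exact: direction_marks.
Qed.

End Realization.

Theorem mainTheorem10 (R : realType) (E : finType) (W : word E) :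
  full W ->
  (exists (Sigma : surface R) (f : pointed_curve Sigma),
      self_transversal f /\ realized_by W f) <-> odd_word W.
Proof.
move=> fullW; split; last exact: odd_word_realized.
by move=> [Sigma [f [st]]]; exact: realized_word_odd.
Qed.
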